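(* Let $M$ be a $6$-manifold endowed with a half-flat $SU(3)$-structure $(F,\Psi_+,\Psi_-)$, with associated metric $g$. Let $X$ be a (nonzero) Killing vector field of constant length on $M$ preserving the $SU(3)$-structure, i.e. $\mathcal L_XF=\mathcal L_X\Psi_+=\mathcal L_X\Psi_-=0$, and satisfying $d\alpha\wedge i_X\Psi_+=0$. Let $N$ be the $5$-manifold formed from the orbits of $X$ in a suitable neighbourhood of a point $p$ with $X_p\ne0$. Then the structure $(\eta,\omega_1,\omega_2,\omega_3)$ on $N$ given by $$\eta=-i_XF,\quad \omega_1=x\,i_X(F\wedge\alpha),\quad \omega_2=i_X\Psi_-,\quad \omega_3=-i_X\Psi_+$$ is hypo. If in addition $i_X(dF-2\Psi_+)=0$, then this $SU(2)$-structure on $N$ is hypo-contact.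
   Context: Here $x=g(X,X)^{1/2}$ and $\alpha$ is the $1$-form $\alpha(Z)=\frac1{x^2}g(Z,X)$. The forms $i_XF$, $x\,i_X(F\wedge\alpha)$, $i_X\Psi_\pm$ are invariant under $X$ and annihilated by $i_X$, hence descend to forms on the local orbit space $N$, denoted by the same expressions. An $SU(3)$-structure on a $6$-manifold is a triple $(F,\Psi_+,\Psi_-)$ for which locally there is a coframe $f^1,\dots,f^6$ with $F=f^{12}+f^{34}+f^{56}$ and $\Psi_++i\Psi_-=(f^1+if^2)\wedge(f^3+if^4)\wedge(f^5+if^6)$; such coframes are orthonormal for the associated metric. It is half-flat if $d(F\wedge F)=0$ and $d\Psi_+=0$. An $SU(2)$-structure on a $5$-manifold is a quadruplet $(\eta,\omega_1,\omega_2,\omega_3)$ with $\eta$ a nowhere vanishing $1$-form and $\omega_i$ $2$-forms such that $\omega_i\wedge\omega_j=\delta_{ij}v$ for some nowhere vanishing $4$-form $v$ with $v\wedge\eta\ne0$, and $i_Y\omega_3=i_Z\omega_1\Rightarrow\omega_2(Y,Z)\ge0$. It is hypo if $d\omega_3=0$, $d(\eta\wedge\omega_1)=0$, $d(\eta\wedge\omega_2)=0$, and hypo-contact if $d\eta=-2\omega_3$, $d(\eta\wedge\omega_1)=0$, $d(\eta\wedge\omega_2)=0$. *)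

(* Defs.v *)
From HB Require Import structures.
From mathcomp Require Import all_boot all_order all_algebra all_fingroup.
From mathcomp Require Import all_classical all_reals all_analysis.
From mathcomp Require Import complex.

Set Implicit Arguments.
Unset Strict Implicit.
Unset Printing Implicit Defensive.

Import Order.TTheory GRing.Theory Num.Theory numFieldNormedType.Exports.

Local Open Scope classical_set_scope.
Local Open Scope ring_scope.

(* C^k maps on a set A, meant to be open *)
Fixpoint Ck (R : realType) (m : nat) (W : normedModType R) (k : nat)
    (f : 'rV[R]_m -> W) (A : set 'rV[R]_m) : Prop :=
  match k with
  | 0 => forall x, A x -> {for x, continuous f}
  | k'.+1 => (forall x, A x -> differentiable f x) /\
             (forall v, Ck k' (fun x => 'D_v f x) A)
  end.

Definition smooth_on (R : realType) (m : nat) (W : normedModType R)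
    (f : 'rV[R]_m -> W) (A : set 'rV[R]_m) : Prop :=
  forall k, Ck k f A.

(* A smooth n-manifold is given by an atlas. [cmap i] is meaningful on
   [cdom i], and [cinv i] on the image [cimg i] of [cdom i] only. *)
Record manifold (R : realType) (n : nat) := Manifold {
  mspace :> topologicalType;
  chart : Type;
  cdom : chart -> set mspace;
  cmap : chart -> mspace -> 'rV[R]_n;
  cinv : chart -> 'rV[R]_n -> mspace;
  cimg : chart -> set 'rV[R]_n := fun i => cmap i @` cdom i;
  manifold_hausdorff : hausdorff_space mspace;
  manifold_second_countable : @second_countable mspace;
  cdom_cover : forall q, exists i, cdom i q;
  open_cdom : forall i, open (cdom i);
  open_cimg : forall i, open (cimg i);
  cmapK : forall i q, cdom i q -> cinv i (cmap i q) = q;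
  cmap_continuous : forall i q, cdom i q -> {for q, continuous (cmap i)};
  cinv_continuous : forall i x, cimg i x -> {for x, continuous (cinv i)};
  transition_smooth : forall i j,
    smooth_on (cmap j \o cinv i) (cmap i @` (cdom i `&` cdom j))
}.

(* A K-valued field of functions of k tangent vectors on R^n; the k vectors are
   the rows of a matrix. *)
Definition lfield (R : realType) (K : Type) (n k : nat) : Type :=
  'rV[R]_n -> 'M[R]_(k, n) -> K.

Section LocalCalculus.
Context (R : realType) (n : nat).

(* linearity in each row, in the style of [determinant_multilinear] *)
Definition multilinear_rows (k : nat) (f : 'M[R]_(k, n) -> R) : Prop :=
  forall (i : 'I_k) (A B C : 'M[R]_(k, n)) (b c : R),
    row i A = b *: row i B + c *: row i C ->
    row' i B = row' i A -> row' i C = row' i A ->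
    f A = b * f B + c * f C.

Definition alternating_rows (k : nat) (f : 'M[R]_(k, n) -> R) : Prop :=
  forall (A : 'M[R]_(k, n)) (i j : 'I_k),
    i != j -> row i A = row j A -> f A = 0.

(* (a /\ b)(v_1, ..., v_{k+l}) = 1/(k! l!) sum_s sgn(s)
     a(v_{s 1}, ..., v_{s k}) b(v_{s (k+1)}, ..., v_{s (k+l)}),
   so that (a /\ b)(v, w) = a(v) b(w) - a(w) b(v) for 1-forms *)
Definition lwedge (K : numFieldType) (k l : nat)
    (a : lfield R K n k) (b : lfield R K n l) : lfield R K n (k + l) :=
  fun x V => ((k`! * l`!)%N%:R)^-1 *
    \sum_(s : 'S_(k + l)) (-1) ^+ s *
      (a x (usubmx (row_perm s V)) * b x (dsubmx (row_perm s V))).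

(* dw(v_0, ..., v_k) = sum_i (-1)^i D_{v_i} (w(v_0, .. omit v_i .., v_k))
   for constant vectors v_i *)
Definition lext (k : nat) (w : lfield R R n k) : lfield R R n k.+1 :=
  fun x V => \sum_(i < k.+1)
    (-1) ^+ i * 'D_(row i V) (fun y => w y (row' i V)) x.

Definition liprod (X : 'rV[R]_n -> 'rV[R]_n) (k : nat)
    (w : lfield R R n k.+1) : lfield R R n k :=
  fun x V => w x (col_mx (X x) V : 'M[R]_(1 + k, n)).

(* the Lie derivative of a covariant tensor field on constant vectors v_a:
   X(T(v_1, ..., v_k)) - sum_a T(v_1, ..., [X, v_a], ..., v_k),
   where [X, v_a] = - D_{v_a} X *)
Definition llie (X : 'rV[R]_n -> 'rV[R]_n) (k : nat)
    (T : lfield R R n k) : lfield R R n k :=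
  fun x V => 'D_(X x) (fun y => T y V) x +
    \sum_(a < k) T x (\matrix_(b < k)
      (if b == a then 'D_(row a V) X x else row b V)).

End LocalCalculus.

Section ManifoldCalculus.
Context (R : realType) (n : nat) (M : manifold R n).

(* Tensor and vector fields are given by their expressions in all charts. Only
   the values on [cimg i] matter. *)
Definition tfield (k : nat) : Type := chart M -> lfield R R n k.
Definition vfield : Type := chart M -> 'rV[R]_n -> 'rV[R]_n.

Definition is_vector_field (X : vfield) : Prop :=
  (forall i, smooth_on (X i) (cimg i)) /\
  (forall i j q, cdom i q -> cdom j q ->
     X j (cmap j q) = X i (cmap i q) *m 'J (cmap j \o cinv i) (cmap i q)).

Definition is_form (k : nat) (w : tfield k) : Prop :=
  [/\ forall i V, smooth_on (fun x => w i x V) (cimg i),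
      forall i x, cimg i x -> multilinear_rows (w i x),
      forall i x, cimg i x -> alternating_rows (w i x) &
      forall i j q, cdom i q -> cdom j q -> forall V,
        w i (cmap i q) V =
        w j (cmap j q) (V *m 'J (cmap j \o cinv i) (cmap i q))].

Definition eq_field (k : nat) (w t : tfield k) : Prop :=
  forall i x, cimg i x -> forall V, w i x V = t i x V.

Definition nowhere_zero (k : nat) (w : tfield k) : Prop :=
  forall i x, cimg i x -> exists V, w i x V != 0.

Definition wedge (k l : nat) (a : tfield k) (b : tfield l) : tfield (k + l) :=
  fun i => lwedge (a i) (b i).

Definition ext (k : nat) (w : tfield k) : tfield k.+1 := fun i => lext (w i).

Definition iprod (X : vfield) (k : nat) (w : tfield k.+1) : tfield k :=
  fun i => liprod (X i) (w i).

Definition lie (X : vfield) (k : nat) (T : tfield k) : tfield k :=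
  fun i => llie (X i) (T i).

Definition fscale (f : chart M -> 'rV[R]_n -> R) (k : nat) (w : tfield k) :
    tfield k :=
  fun i x V => f i x * w i x V.

(* g(X, X)^(1/2) *)
Definition field_length (g : tfield 2) (X : vfield) :
    chart M -> 'rV[R]_n -> R :=
  fun i x => Num.sqrt (g i x (col_mx (X i x) (X i x))).

(* the 1-form Z |-> g(Z, X) / g(X, X) *)
Definition dual_form (g : tfield 2) (X : vfield) : tfield 1 :=
  fun i x Z => (field_length g X i x ^+ 2)^-1 * g i x (col_mx Z (X i x)).

Definition killing (g : tfield 2) (X : vfield) : Prop :=
  eq_field (lie X g) 0.

Definition constant_length (g : tfield 2) (X : vfield) : Prop :=
  exists c : R, forall i x, cimg i x -> field_length g X i x = c.

Definition integral_curve (X : vfield) (U : set M) (a b : R) (c : R -> M) :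
    Prop :=
  forall t, a < t < b ->
    [/\ U (c t), {for t, continuous c} &
        forall i, cdom i (c t) ->
          is_derive t 1 (cmap i \o c) (X i (cmap i (c t)))].

(* q and q' lie on the same orbit of the restriction of X to U *)
Definition same_orbit (X : vfield) (U : set M) (q q' : M) : Prop :=
  exists (a b : R) (c : R -> M), integral_curve X U a b c /\
    exists s t, [/\ a < s < b, a < t < b, c s = q & c t = q'].

End ManifoldCalculus.

Arguments nowhere_zero {R n M k} w.

Notation "a \wedge b" := (wedge a b)
  (at level 40, left associativity) : ring_scope.

Section Quotient.
Context (R : realType) (m n : nat) (M : manifold R m) (N : manifold R n).

Definition local_map (pr : M -> N) (i : chart M) (j : chart N) :
    'rV[R]_m -> 'rV[R]_n :=
  cmap j \o pr \o cinv i.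

Definition smooth_map_on (U : set M) (pr : M -> N) : Prop :=
  (forall q, U q -> {for q, continuous pr}) /\
  (forall i j, smooth_on (local_map pr i j)
                 (cmap i @` (cdom i `&` U `&` pr @^-1` cdom j))).

(* [row_full] of the Jacobian: v |-> v *m 'J is onto *)
Definition submersion_on (U : set M) (pr : M -> N) : Prop :=
  smooth_map_on U pr /\
  forall q i j, U q -> cdom i q -> cdom j (pr q) ->
    row_full ('J (local_map pr i j) (cmap i q)).

(* N is the manifold of orbits of X in the open set U, with projection pr; the
   values of pr outside U are irrelevant. *)
Definition orbit_space (X : vfield M) (U : set M) (pr : M -> N) : Prop :=
  [/\ open U,
      submersion_on U pr,
      pr @` U = setT &
      forall q q', U q -> U q' -> (pr q = pr q' <-> same_orbit X U q q')].

(* w descends to t: the pullback of t by pr is the restriction of w to U *)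
Definition descends_to (U : set M) (pr : M -> N) (k : nat)
    (w : tfield M k) (t : tfield N k) : Prop :=
  forall q i j, U q -> cdom i q -> cdom j (pr q) -> forall V,
    w i (cmap i q) V =
    t j (cmap j (pr q)) (V *m 'J (local_map pr i j) (cmap i q)).

End Quotient.

Section SU3.
Context (R : realType).

Definition complex_form (k : nat) (a b : lfield R R 6 k) :
    lfield R R[i] 6 k :=
  fun x V => (a x V +i* b x V)%C.

(* The coframe f^1, ..., f^6 is f 0, ..., f 5. *)
Definition adapted_coframe (A : set 'rV[R]_6) (f : 'I_6 -> lfield R R 6 1)
    (F : lfield R R 6 2) (Psip Psim : lfield R R 6 3) : Prop :=
  [/\ forall a V, smooth_on (fun x => f a x V) A,
      forall a x, A x -> multilinear_rows (f a x),
      forall x, A x -> forall c : 'I_6 -> R,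
        (forall v, \sum_a c a * f a x v = 0) -> forall a, c a = 0,
      forall x, A x -> forall V,
        F x V = lwedge (f 0) (f 1) x V + lwedge (f 2) (f 3) x V
                + lwedge (f 4) (f 5) x V &
      forall x, A x -> forall V,
        complex_form Psip Psim x V =
        lwedge (lwedge (complex_form (f 0) (f 1)) (complex_form (f 2) (f 3)))
               (complex_form (f 4) (f 5)) x V].

Context (M : manifold R 6).

Definition su3_structure (F : tfield M 2) (Psip Psim : tfield M 3) : Prop :=
  [/\ is_form F, is_form Psip, is_form Psim &
      forall i x, cimg i x -> exists A f,
        [/\ open A, A x, A `<=` cimg i &
            adapted_coframe A f (F i) (Psip i) (Psim i)]].

(* the tensor g for which every adapted coframe is orthonormal *)
Definition associated_metric (F : tfield M 2) (Psip Psim : tfield M 3)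
    (g : tfield M 2) : Prop :=
  forall i A f, open A -> A `<=` cimg i ->
    adapted_coframe A f (F i) (Psip i) (Psim i) ->
    forall x, A x -> forall V : 'M[R]_(2, 6),
      g i x V = \sum_a f a x (row 0 V) * f a x (row 1 V).

Definition half_flat (F : tfield M 2) (Psip Psim : tfield M 3) : Prop :=
  [/\ su3_structure F Psip Psim,
      eq_field (ext (F \wedge F)) 0 &
      eq_field (ext Psip) 0].

End SU3.

Section SU2.
Context (R : realType) (N : manifold R 5).

Definition su2_structure (eta : tfield N 1) (w1 w2 w3 : tfield N 2) : Prop :=
  let w : 'I_3 -> tfield N 2 := tnth [tuple w1; w2; w3] in
  [/\ is_form eta /\ nowhere_zero eta,
      forall a, is_form (w a),
      exists v : tfield N 4,
        [/\ is_form v, nowhere_zero v, nowhere_zero (v \wedge eta) &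
            forall a b, eq_field (w a \wedge w b) ((a == b)%:R *: v)] &
      forall i x, cimg i x -> forall Y Z : 'rV[R]_5,
        (forall v : 'rV[R]_5,
           w3 i x (col_mx Y v) = w1 i x (col_mx Z v)) ->
        0 <= w2 i x (col_mx Y Z)].

Definition hypo (eta : tfield N 1) (w1 w2 w3 : tfield N 2) : Prop :=
  [/\ su2_structure eta w1 w2 w3,
      eq_field (ext w3) 0,
      eq_field (ext (eta \wedge w1)) 0 &
      eq_field (ext (eta \wedge w2)) 0].

Definition hypo_contact (eta : tfield N 1) (w1 w2 w3 : tfield N 2) : Prop :=
  [/\ su2_structure eta w1 w2 w3,
      eq_field (ext eta) (- 2 *: w3),
      eq_field (ext (eta \wedge w1)) 0 &
      eq_field (ext (eta \wedge w2)) 0].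

End SU2.

(* Main.v *)
(* Pulling back along the submersion M -> N is injective and commutes with the
   wedge product and with d, so all equations are checked upstairs. At a point,
   SU(3) acting transitively on spheres provides an adapted coframe in which
   X = x e_1; it shows that
     eta /\ omega_1 = - (x / 2) i_X (F /\ F),
     eta /\ omega_2 = x^2 (Psi_+ - alpha /\ i_X Psi_+),
   and that (eta, omega_i) is, up to scaling, the standard SU(2)-structure
   (- f^2, f^34 + f^56, f^36 + f^45, f^46 - f^35). By Cartan's formula
   d i_X w = - i_X d w for w = F, F /\ F, Psi_+, so eta /\ omega_1 and omega_3
   are closed, d eta = i_X dF, and
     d (eta /\ omega_2) = - x^2 d alpha /\ i_X Psi_+ = 0. *)

Require Import Defs.
From mathcomp Require Import all_boot all_order all_algebra all_fingroup.
From mathcomp Require Import all_classical all_reals all_analysis.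
From mathcomp Require Import complex zify ring lra.

Set Implicit Arguments.
Unset Strict Implicit.
Unset Printing Implicit Defensive.

Import Order.TTheory GRing.Theory Num.Theory numFieldNormedType.Exports.

Local Open Scope classical_set_scope.
Local Open Scope ring_scope.

(** * Wedge products evaluated on rows *)

(** A k-form is a function of a matrix of k rows in each chart, and d is defined by derivatives
    along constant vectors. Neither contraction with X nor pullback keeps the arguments constant, so
    Cartan's formula and the compatibility of d with pullback both reduce to one Leibniz rule for a
    multilinear function whose rows move, [is_derive_multilinear]. For the pullback the extra terms
    contain second derivatives of the projection and cancel by their symmetry, which is derived from
    a mean value estimate. The coframe with X = x e_1 is chosen separately at each point and has no
    reason to vary smoothly. It serves only to prove identities between values; these no longer
    mention it, hold throughout a chart, and can then be differentiated. The metric is likewise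
    known only through adapted coframes, so the differentiability of alpha comes from a smooth local
    coframe and the constancy of x. Wedge products are normalized sums over permutations. On
    explicit lists of rows they become short expansions, which turns the pointwise identities into
    polynomial ones in coframe coordinates. *)

Lemma sum_lift_perm (V : nmodType) (n : nat) (i0 : 'I_n.+1)
    (f : 'S_n.+1 -> V) :
  \sum_s f s = \sum_j \sum_(s : 'S_n) f (lift_perm i0 j s).
Proof.
rewrite pair_big /=.
(* A permutation is the image of [i0] together with the permutation that it induces on the other
   indices. *)
pose h (p : 'I_n.+1 * 'S_n) := lift_perm i0 p.1 p.2.
have hinj : injective h.
  move=> [j s] [j' s'] /permP e.
  have ej : j = j' by have := e i0; rewrite /h /= !lift_perm_id.
  congr (_, _) => //; apply/permP => k; have := e (lift i0 k).
  by rewrite /h /= !lift_perm_lift -ej => /lift_inj.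
have hbij : bijective h.
  by apply: inj_card_bij hinj _; rewrite card_prod !card_Sn card_ord factS.
by rewrite (reindex h) //; apply: onW_bij.
Qed.

(** [G] takes natural numbers, not ordinals, so that the images compute to numerals once the
    permutations are peeled off one index at a time. *)
Lemma sum_perm4 (R : pzRingType) (G : nat -> nat -> nat -> nat -> R) :
  \sum_(s : 'S_4) (-1) ^+ s *
    G (s ord0) (s (lift ord0 ord0)) (s (lift ord0 (lift ord0 ord0)))
      (s (lift ord0 (lift ord0 (lift ord0 ord0)))) =
  (G 0 1 2 3)%N - (G 0 1 3 2)%N - (G 0 2 1 3)%N + (G 0 2 3 1)%N
  + (G 0 3 1 2)%N - (G 0 3 2 1)%N - (G 1 0 2 3)%N + (G 1 0 3 2)%N
  + (G 1 2 0 3)%N - (G 1 2 3 0)%N - (G 1 3 0 2)%N + (G 1 3 2 0)%N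
  + (G 2 0 1 3)%N - (G 2 0 3 1)%N - (G 2 1 0 3)%N + (G 2 1 3 0)%N
  + (G 2 3 0 1)%N - (G 2 3 1 0)%N - (G 3 0 1 2)%N + (G 3 0 2 1)%N
  + (G 3 1 0 2)%N - (G 3 1 2 0)%N - (G 3 2 0 1)%N + (G 3 2 1 0)%N.
Proof.
rewrite (sum_lift_perm ord0).
under eq_bigr do rewrite (sum_lift_perm ord0).
under eq_bigr do under eq_bigr do rewrite (sum_lift_perm ord0).
under eq_bigr do under eq_bigr do under eq_bigr do rewrite (sum_lift_perm ord0).
rewrite !big_ord_recl !big_ord0 !addr0.
have E0 (f : 'S_0 -> R) : \sum_s f s = f 1%g.
  rewrite (bigD1 1%g) //= big1 ?addr0 // => s.
  by rewrite permS0 eqxx.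
rewrite !E0 !lift_perm_lift !lift_perm_id !odd_lift_perm /= !odd_perm1 /=.
rewrite /bump /= !addn0 !addn1 /= !(expr0, expr1) !mul1r !mulN1r !addrA.
by [].
Qed.

Section Rows.
Context (K : nmodType) (n : nat).
Implicit Types (s : seq 'rV[K]_n).

(** Rows are kept in a list so that removing or prepending one is a computation. Missing rows
    default to 0, which spares size hypotheses. *)
Definition mxrows (k : nat) s : 'M[K]_(k, n) := \matrix_(i < k) s`_i.

Lemma row_mxrows k s i : row i (mxrows k s) = s`_i.
Proof. by rewrite rowK. Qed.

Lemma mxrowsE k (V : 'M[K]_(k, n)) :
  V = mxrows k [seq row i V | i <- enum 'I_k].
Proof.
apply/row_matrixP => i; rewrite row_mxrows (nth_map i) ?size_enum_ord //.
by rewrite nth_ord_enum.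
Qed.

Lemma col_mx_mxrows k (u : 'rV[K]_n) s :
  col_mx u (mxrows k s) = mxrows (1 + k) (u :: s).
Proof.
apply/row_matrixP => i; rewrite row_mxrows -(fintype.splitK i).
case: (fintype.split i) => j; first by rewrite rowKu row_id ord1.
by rewrite rowKd row_mxrows.
Qed.

Lemma usubmx_row_perm k l (sg : 'S_(k + l)) s :
  usubmx (row_perm sg (mxrows (k + l) s)) =
  mxrows k [seq s`_(sg (lshift l i)) | i <- enum 'I_k].
Proof.
apply/row_matrixP => i; rewrite row_mxrows (nth_map i) ?size_enum_ord //.
rewrite nth_ord_enum; apply/rowP => j.
by rewrite !mxE.
Qed.

Lemma dsubmx_row_perm k l (sg : 'S_(k + l)) s :
  dsubmx (row_perm sg (mxrows (k + l) s)) =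
  mxrows l [seq s`_(sg (rshift k i)) | i <- enum 'I_l].
Proof.
apply/row_matrixP => i; rewrite row_mxrows (nth_map i) ?size_enum_ord //.
rewrite nth_ord_enum; apply/rowP => j.
by rewrite !mxE.
Qed.

Lemma row'_mxrows k s i :
  row' i (mxrows k.+1 s) = mxrows k (take i s ++ drop i.+1 s).
Proof.
apply/row_matrixP => j; rewrite row_mxrows; apply/rowP => c; rewrite !mxE.
congr (_ _ _); rewrite nth_cat size_take /= /bump.
case: (ltnP i (size s)) => si.
  case: (ltnP j i) => ij; first by rewrite add0n nth_take.
  by rewrite nth_drop add1n addSn subnKC.
case: (ltnP j (size s)) => sj.
  by rewrite leqNgt (leq_trans sj si) add0n nth_take ?(leq_trans sj).
by rewrite drop_oversize ?(leq_trans si) // nth_nil nth_default // (leq_trans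
  sj) ?leq_addl.
Qed.

End Rows.

Lemma mxrows_mul (R : pzRingType) (m n k : nat) (s : seq 'rV[R]_m) (A :
  'M[R]_(m, n)) :
  mxrows k s *m A = mxrows k [seq u *m A | u <- s].
Proof.
apply/row_matrixP => i; rewrite row_mul !row_mxrows.
case: (ltnP i (size s)) => si; first by rewrite (nth_map 0).
by rewrite !nth_default ?mul0mx // size_map.
Qed.

(** Stated as a sign rule and over any coefficient ring [K], because sums over ['S_k] are simplified
    by that rule and the complex volume form takes values in [R[i]]. *)
Definition antisym_rows (R : nzRingType) (K : pzRingType) (k n : nat)
    (f : 'M[R]_(k, n) -> K) : Prop :=
  forall (s : 'S_k) V, f (row_perm s V) = (-1) ^+ s * f V.

Lemma antisym_rows1 (R : nzRingType) (K : pzRingType) (n : nat)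
    (f : 'M[R]_(1, n) -> K) : antisym_rows f.
Proof. by move=> s V; rewrite permS1 row_perm1 odd_perm1 mul1r. Qed.

Lemma antisym_rows2 (R : nzRingType) (K : pzRingType) (n : nat)
    (f : 'M[R]_(2, n) -> K) : antisym_rows f ->
  forall u v, f (mxrows 2 [:: u; v]) = - f (mxrows 2 [:: v; u]).
Proof.
move=> hf u v; rewrite -[RHS]mulN1r.
have <- : ((-1) ^+ tperm (0 : 'I_2) 1 : K) = -1 by rewrite odd_tperm.
rewrite -hf; congr (f _); apply/row_matrixP => i.
rewrite row_mxrows; apply/rowP => c0; rewrite !mxE.
case: tpermP => [->|->|/eqP h0 /eqP h1] //.
by case: i h0 h1 => [[|[|]]].
Qed.

Section Wedge.
Context (R : realType) (K : numFieldType) (n : nat).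

(** Antisymmetrization gives this for arbitrary factors: the permutation of the rows is absorbed by
    reindexing the sum. *)
Lemma lwedge_antisym (k l : nat) (a : lfield R K n k) (b : lfield R K n l) x :
  antisym_rows (lwedge a b x).
Proof.
move=> t V; rewrite /lwedge mulrCA; congr (_ * _).
rewrite (reindex_inj (mulIg (t^-1)%g)) /= big_distrr /=; apply: eq_bigr => s _.
by rewrite -row_permM -mulgA mulVg mulg1 odd_permM odd_permV signr_addb
  [RHS]mulrCA -mulrA.
Qed.

(** By antisymmetry of [b x], the l! permutations with a given image of the first index contribute
    equally, which cancels the factorial. *)
Lemma lwedge1l (l : nat) (a : lfield R K n 1) (b : lfield R K n l) x :
  antisym_rows (b x) -> forall V : 'M[_]_(1 + l, n),
  lwedge a b x V = \sum_(i < l.+1) (-1) ^+ i * (a x (row i V) * b x (row' i V)).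
Proof.
move=> hb V; rewrite /lwedge (@sum_lift_perm _ l ord0) big_distrr /=.
apply: eq_bigr => i _.
have E (s : 'S_l) : (-1) ^+ lift_perm ord0 i s *
    (a x (usubmx (row_perm (lift_perm ord0 i s) V : 'M[_]_(1 + l, n))) *
     b x (dsubmx (row_perm (lift_perm ord0 i s) V : 'M[_]_(1 + l, n)))) =
    (-1) ^+ i * (a x (row i V) * b x (row' i V)).
  have -> : usubmx (row_perm (lift_perm ord0 i s) V : 'M[_]_(1 + l, n)) = row i
    V.
    apply/rowP => c; rewrite !mxE.
    have e : @lshift 1 l ord0 = ord0 :> 'I_l.+1 by exact: val_inj.
    by rewrite e lift_perm_id.
  have -> : dsubmx (row_perm (lift_perm ord0 i s) V : 'M[_]_(1 + l, n)) =
            row_perm s (row' i V).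
    apply/matrixP => r c; rewrite !mxE.
    have e : @rshift 1 l r = lift ord0 r :> 'I_l.+1 by exact: val_inj.
    by rewrite e lift_perm_lift.
  rewrite hb odd_lift_perm /= signr_addb signr_odd -mulrA; congr (_ * _).
  by rewrite mulrCA [_ ^+ s * (_ ^+ s * _)]mulrA -signr_addb addbb mul1r.
rewrite (eq_bigr _ (fun s _ => E s)) sumr_const card_Sn -[_ *+ l`!]mulr_natl
  mul1n.
by rewrite mulKf // pnatr_eq0 -lt0n fact_gt0.
Qed.

(* Expansion along the last argument; [1 + k] and [k + 1] are both [k.+1] only
   for a closed [k], hence the formulation with [rowsub]. *)
Lemma sum_perm_last (k : nat) (a : 'M[R]_(k, n) -> K) (b : 'rV[R]_n -> K) :
  antisym_rows a -> forall V : 'M[_]_(k.+1, n),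
  \sum_(s : 'S_k.+1) (-1) ^+ s *
    (a (rowsub (fun i => s (lift ord_max i)) V) * b (row (s ord_max) V)) =
  (k`!)%:R * \sum_(i < k.+1) (-1) ^+ (k + i) * (a (row' i V) * b (row i V)).
Proof.
move=> ha V; rewrite (sum_lift_perm ord_max) big_distrr /=.
apply: eq_bigr => i _.
have E (s : 'S_k) : (-1) ^+ lift_perm ord_max i s *
    (a (rowsub (fun j => lift_perm ord_max i s (lift ord_max j)) V) *
     b (row (lift_perm ord_max i s ord_max) V)) =
    (-1) ^+ (k + i) * (a (row' i V) * b (row i V)).
  have -> : rowsub (fun j => lift_perm ord_max i s (lift ord_max j)) V =
            row_perm s (row' i V).
    by apply/matrixP => r c; rewrite !mxE lift_perm_lift.
  rewrite ha odd_lift_perm lift_perm_id /= -oddD signr_addb signr_odd -mulrA.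
  congr (_ * _).
  by rewrite !mulrA -signr_addb addbb mul1r.
by rewrite (eq_bigr _ (fun s _ => E s)) sumr_const card_Sn mulr_natl.
Qed.

Lemma lwedge21 (a : lfield R K n 2) (b : lfield R K n 1) x :
  antisym_rows (a x) -> forall V : 'M[_]_(3, n),
  lwedge a b x V =
    a x (row' ord_max V) * b x (row ord_max V)
    - a x (row' 1 V) * b x (row 1 V) + a x (row' 0 V) * b x (row 0 V).
Proof.
move=> ha V; rewrite /lwedge.
transitivity ((2`! * 1`!)%:R^-1 * \sum_(s : 'S_3) (-1) ^+ s *
    (a x (rowsub (fun i => s (lift ord_max i)) V) * b x (row (s ord_max) V))).
  congr (_ * _); apply: eq_bigr => s _; congr (_ * (a x _ * b x _)).
    by apply/matrixP => i j; rewrite !mxE; congr (V (s _) _); apply: val_inj;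
      rewrite /= /bump leqNgt ltn_ord.
  by apply/matrixP => i j; rewrite !mxE; congr (V (s _) _); apply: val_inj;
    rewrite /= ord1.
rewrite sum_perm_last // muln1 mulrA mulVf ?mul1r ?pnatr_eq0 // !big_ord_recr
  big_ord0 /=.
rewrite add0r addrC -[RHS]addrA [- _ + _]addrC !addn0 !addn1 !addn2 !exprS expr0
  mulr1 !(mulN1r, mulrNN, mul1r, mulr1, opprK).
have -> : widen_ord (leqnSn 2) (widen_ord (leqnSn 1) ord_max) = 0 by exact:
  val_inj.
by have -> : widen_ord (leqnSn 2) ord_max = 1 by exact: val_inj.
Qed.

(** Meant for v /\ eta, evaluated on four vectors killed by eta followed by one that is not: a
    single term of the expansion survives. *)
Lemma lwedge41 (a : lfield R K n 4) (b : lfield R K n 1) x (V : 'M[_]_(5, n)) :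
  antisym_rows (a x) -> (forall i : 'I_4, b x (row (lift ord_max i) V) = 0) ->
  lwedge a b x V = a x (row' ord_max V) * b x (row ord_max V).
Proof.
move=> ha hb; rewrite /lwedge.
transitivity ((4`! * 1`!)%:R^-1 * \sum_(s : 'S_5) (-1) ^+ s *
    (a x (rowsub (fun i => s (lift ord_max i)) V) * b x (row (s ord_max) V))).
  congr (_ * _); apply: eq_bigr => s _; congr (_ * (a x _ * b x _)).
    by apply/matrixP => i j; rewrite !mxE; congr (V (s _) _); apply: val_inj;
      rewrite /= /bump leqNgt ltn_ord.
  by apply/matrixP => i j; rewrite !mxE; congr (V (s _) _); apply: val_inj;
    rewrite /= ord1.
rewrite sum_perm_last // muln1 mulrA mulVf ?mul1r ?pnatr_eq0 // big_ord_recr /=.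
rewrite big1 ?add0r => [|i _]; last first.
  by rewrite (_ : widen_ord _ _ = lift ord_max i) ?hb ?mulr0 //; apply: val_inj;
    rewrite /= /bump leqNgt ltn_ord.
by rewrite -signr_odd /= mul1r.
Qed.

Lemma lwedge22 (a b : lfield R K n 2) x :
  antisym_rows (a x) -> antisym_rows (b x) -> forall u v w z : 'rV_n,
  lwedge a b x (mxrows 4 [:: u; v; w; z]) =
  let A u v := a x (mxrows 2 [:: u; v]) in
  let B u v := b x (mxrows 2 [:: u; v]) in
  A u v * B w z - A u w * B v z + A u z * B v w
  + A v w * B u z - A v z * B u w + A w z * B u v.
Proof.
move=> ha hb u v w z /=.
pose A u v := a x (mxrows 2 [:: u; v]); pose B u v := b x (mxrows 2 [:: u; v]).
rewrite -!/(A _ _) -!/(B _ _).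
pose s := [:: u; v; w; z].
pose G i j k l := A s`_i s`_j * B s`_k s`_l.
rewrite /lwedge (_ : \sum_(_ | _) _ = \sum_(s : 'S_4) (-1) ^+ s *
    G (s ord0) (s (lift ord0 ord0)) (s (lift ord0 (lift ord0 ord0)))
      (s (lift ord0 (lift ord0 (lift ord0 ord0))))); last first.
  apply: eq_bigr => t _; rewrite usubmx_row_perm dsubmx_row_perm.
  rewrite !enum_ordSl !enum_ord0 /= /G /A /B.
  have e0 : @lshift 2 2 ord0 = ord0 :> 'I_4 by exact: val_inj.
  have e1 : @lshift 2 2 (lift ord0 ord0) = lift ord0 ord0 :> 'I_4.
    exact: val_inj.
  have e2 : @rshift 2 2 ord0 = lift ord0 (lift ord0 ord0) :> 'I_4.
    exact: val_inj.
  have e3 : @rshift 2 2 (lift ord0 ord0) =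
            lift ord0 (lift ord0 (lift ord0 ord0)) :> 'I_4 by exact: val_inj.
  by rewrite e0 e1 e2 e3.
rewrite sum_perm4 /G /=.
have hA u' v' : A u' v' = - A v' u' by exact: antisym_rows2.
have hB u' v' : B u' v' = - B v' u' by exact: antisym_rows2.
rewrite (hA v u) (hA w u) (hA w v) (hA z u) (hA z v) (hA z w).
rewrite (hB v u) (hB w u) (hB w v) (hB z u) (hB z v) (hB z w).
by rewrite (_ : 2`! * 2`! = 4)%N //; field.
Qed.

End Wedge.

(** * Multilinear and alternating functions of rows *)

Section Multilinear.
Context (R : realType) (n : nat).

(** Spelled exactly as the matrix in [llie], so that the two are convertible. *)
Definition mxset (k : nat) (a : 'I_k) (u : 'rV[R]_n) (V : 'M[R]_(k, n)) :
    'M[R]_(k, n) :=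
  \matrix_(b < k) (if b == a then u else row b V).

Lemma row_mxset k (a b : 'I_k) u V :
  row b (mxset a u V) = if b == a then u else row b V.
Proof. by rewrite rowK. Qed.

Lemma mxset_id k (a : 'I_k) V : mxset a (row a V) V = V.
Proof. by apply/row_matrixP => b; rewrite row_mxset; case: eqP => [->|]. Qed.

Lemma mxsetC k (a b : 'I_k) u v V : a != b ->
  mxset a u (mxset b v V) = mxset b v (mxset a u V).
Proof.
move=> ab; apply/row_matrixP => c; rewrite !row_mxset.
by case: eqP => [->|//]; rewrite (negPf ab).
Qed.

Lemma row'_mxset k (a : 'I_k) u V : row' a (mxset a u V) = row' a V.
Proof.
apply/row_matrixP => b; rewrite !row_rowsub row_mxset.
by rewrite eq_sym (negPf (neq_lift _ _)).
Qed.

Lemma mxset_col_mx k u v (V : 'M[R]_(k, n)) :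
  mxset (ord0 : 'I_(1 + k)) u (col_mx v V) = col_mx u V.
Proof.
apply/row_matrixP => b; rewrite row_mxset -(fintype.splitK b).
case: (fintype.split b) => j; first by rewrite ord1 !rowKu !row_id.
by rewrite !rowKd.
Qed.

Lemma multilinear_mxset k (f : 'M[R]_(k, n) -> R) : multilinear_rows f ->
  forall a V (b c : R) u v,
  f (mxset a (b *: u + c *: v) V) = b * f (mxset a u V) + c * f (mxset a v V).
Proof.
move=> hf a V b c u v; apply: (hf a).
- by rewrite !row_mxset !eqxx.
- by rewrite !row'_mxset.
- by rewrite !row'_mxset.
Qed.

Lemma scalar_sum_delta (g : 'rV[R]_n -> R) :
  (forall (b c : R) u v, g (b *: u + c *: v) = b * g u + c * g v) ->
  forall u, g u = \sum_j u 0 j * g (delta_mx 0 j).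
Proof.
move=> hg u; rewrite {1}(row_sum_delta u).
have gD : {morph g : u v / u + v >-> u + v}.
  by move=> v w; have := hg 1 1 v w; rewrite !scale1r !mul1r.
have g0 : g 0 = 0.
  by have := hg 0 0 0 0; rewrite !scale0r !mul0r !addr0.
rewrite (big_morph g gD g0); apply: eq_bigr => j _.
by have := hg (u 0 j) 0 (delta_mx 0 j) 0; rewrite scale0r mul0r !addr0.
Qed.

Lemma multilinear_delta k (f : 'M[R]_(k, n) -> R) : multilinear_rows f ->
  forall a u V,
  f (mxset a u V) = \sum_j u 0 j * f (mxset a (delta_mx 0 j) V).
Proof.
move=> hf a u V; apply: (scalar_sum_delta (g := fun u => f (mxset a u V))).
exact: multilinear_mxset.
Qed.

Lemma multilinear_mxset0 k (f : 'M[R]_(k, n) -> R) : multilinear_rows f ->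
  forall a V, f (mxset a 0 V) = 0.
Proof.
by move=> hf a V; rewrite multilinear_delta // big1 // => j _; rewrite mxE
  mul0r.
Qed.

(** Polarization: putting [row i W + row j W] in both places gives 0, and the expansion leaves the
    values at [W] and at its transposition. A general permutation is a product of transpositions. *)
Lemma antisym_alternating k (f : 'M[R]_(k, n) -> R) :
  multilinear_rows f -> alternating_rows f -> antisym_rows f.
Proof.
move=> hm ha s V.
have swap (i j : 'I_k) W : i != j -> f (row_perm (tperm i j) W) = - f W.
  move=> ij.
  pose D u v := mxset j v (mxset i u W).
  have D0 u : f (D u u) = 0.
    by apply: (ha _ i j ij); rewrite !row_mxset !eqxx (negPf ij).
  have D1 u u' v : f (D (u + u') v) = f (D u v) + f (D u' v).
    have ji : j != i by rewrite eq_sym.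
    rewrite /D !(mxsetC _ _ _ ji).
    by have := multilinear_mxset hm i (mxset j v W) 1 1 u u'; rewrite !scale1r
      !mul1r.
  have D2 u v v' : f (D u (v + v')) = f (D u v) + f (D u v').
    by have := multilinear_mxset hm j (mxset i u W) 1 1 v v'; rewrite !scale1r
      !mul1r.
  have := D0 (row i W + row j W); rewrite D1 !D2 !D0 add0r addr0.
  have -> : D (row i W) (row j W) = W by rewrite /D mxset_id mxset_id.
  have -> : D (row j W) (row i W) = row_perm (tperm i j) W.
    apply/row_matrixP => c; rewrite row_permEsub row_rowsub !row_mxset.
    case: tpermP => [->|->|/eqP/negPf-> /eqP/negPf->] //; last by rewrite eqxx.
    by rewrite (negPf ij) eqxx.
  by move/eqP; rewrite addrC addr_eq0 => /eqP.
case: (prod_tpermP s) => ts ->{s} hts; elim: ts hts V => [|t ts IH] /= hts V.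
  by rewrite big_nil row_perm1 odd_perm1 mul1r.
case/andP: hts => ht /IH{}IH; rewrite big_cons row_permM swap // IH.
by rewrite odd_mul_tperm ht signr_addb expr1 mulN1r mulNr.
Qed.

(** Exchanging two equal rows changes the sign but not the matrix, and 2 is invertible in [R]. *)
Lemma alternating_antisym k (f : 'M[R]_(k, n) -> R) :
  antisym_rows f -> alternating_rows f.
Proof.
move=> hf V i j ij e; have := hf (tperm i j) V.
have -> : row_perm (tperm i j) V = V.
  apply/row_matrixP => c; rewrite row_permEsub row_rowsub.
  by case: tpermP => [->|->|].
by rewrite odd_tperm ij expr1; lra.
Qed.

Lemma antisym_mxset k (f : 'M[R]_(k.+1, n) -> R) : antisym_rows f ->
  forall a u V, f (mxset a u V) = (-1) ^+ a * f (col_mx u (row' a V)).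
Proof.
move=> hf a u V.
(* The cycle that moves index [a] to the front has sign (-1)^a. *)
have <- : (-1) ^+ lift_perm a ord0 (1%g : 'S_k) = (-1) ^+ a :> R.
  by rewrite odd_lift_perm odd_perm1 !addbF signr_odd.
rewrite -hf; congr (f _); apply/row_matrixP => b.
rewrite row_permEsub row_rowsub row_mxset.
case: (unliftP a b) => [c ->|->].
  rewrite eq_sym (negPf (neq_lift _ _)) lift_perm_lift perm1.
  have e : lift ord0 c = @rshift 1 k c :> 'I_(1 + k) by exact: val_inj.
  by rewrite e (@rowKd _ 1 k) row_rowsub.
rewrite eqxx lift_perm_id.
have e : ord0 = @lshift 1 k ord0 :> 'I_(1 + k) by exact: val_inj.
by rewrite e (@rowKu _ 1 k) row_id.
Qed.

Lemma lwedge_multilinear (k l : nat) (a : lfield R R n k) (b : lfield R R n l) x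
  :
  multilinear_rows (a x) -> multilinear_rows (b x) ->
  multilinear_rows (lwedge a b x).
Proof.
move=> ha hb i A B C p q hA hB hC.
rewrite /lwedge !(mulrCA p) !(mulrCA q) -mulrDr; congr (_ * _).
rewrite !big_distrr -big_split /=; apply: eq_bigr => s _.
have rowE r (W : 'M[R]_(k + l, n)) : row r (row_perm s W) = row (s r) W.
  by rewrite row_permEsub row_rowsub.
have other r W : s r != i -> row' i W = row' i A ->
    row (s r) W = row (s r) A.
  move=> hr e; case: (unliftP i (s r)) hr => [c ->|->]; last by rewrite eqxx.
  by move=> _; rewrite -!row_rowsub -!row'Esub e.
have us W : row' i W = row' i A -> (forall r, s (lshift l r) != i) ->
    usubmx (row_perm s W) = usubmx (row_perm s A).
  by move=> e hr; apply/row_matrixP => r; rewrite !row_usubmx !rowE other.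
have ds W : row' i W = row' i A -> (forall r, s (rshift k r) != i) ->
    dsubmx (row_perm s W) = dsubmx (row_perm s A).
  by move=> e hr; apply/row_matrixP => r; rewrite !row_dsubmx !rowE other.
have si : s (s^-1%g i) = i by rewrite permKV.
(* In the term of [s], row [i] enters only one of the two factors, the one that contains position
   [s^-1 i]. *)
case: (fintype.splitP (s^-1%g i)) => r er.
  have {}er : s (lshift l r) = i by rewrite -si; congr (s _); exact: val_inj.
  have hr r' : s (rshift k r') != i.
    by rewrite -er (inj_eq perm_inj) eq_sym eq_lrshift.
  have ul W : row' i W = row' i A ->
      row' r (usubmx (row_perm s W)) = row' r (usubmx (row_perm s A)).
    move=> e; apply/row_matrixP => c; rewrite !row'Esub !row_rowsub.
    rewrite !row_usubmx !rowE other //.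
    by rewrite -er (inj_eq perm_inj) eq_lshift eq_sym neq_lift.
  rewrite (ds B) // (ds C) //.
  have hr0 : row r (usubmx (row_perm s A)) =
      p *: row r (usubmx (row_perm s B)) + q *: row r (usubmx (row_perm s C)).
    by rewrite !row_usubmx !rowE er.
  rewrite (ha r _ _ _ p q hr0 (ul B hB) (ul C hC)).
  by move: ((-1) ^+ s) => e; ring.
have {}er : s (rshift k r) = i by rewrite -si; congr (s _); exact: val_inj.
have hr r' : s (lshift l r') != i.
  by rewrite -er (inj_eq perm_inj) eq_lrshift.
have ul W : row' i W = row' i A ->
    row' r (dsubmx (row_perm s W)) = row' r (dsubmx (row_perm s A)).
  move=> e; apply/row_matrixP => c; rewrite !row'Esub !row_rowsub.
  rewrite !row_dsubmx !rowE other //.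
  by rewrite -er (inj_eq perm_inj) eq_rshift eq_sym neq_lift.
rewrite (us B) // (us C) //.
have hr0 : row r (dsubmx (row_perm s A)) =
    p *: row r (dsubmx (row_perm s B)) + q *: row r (dsubmx (row_perm s C)).
  by rewrite !row_dsubmx !rowE er.
rewrite (hb r _ _ _ p q hr0 (ul B hB) (ul C hC)).
by move: ((-1) ^+ s) => e; ring.
Qed.

End Multilinear.

(** * Exterior derivative, Cartan's formula and pullbacks *)

Section MultilinearDerivative.
Context (R : realType) (V : normedModType R).

Lemma is_derive_fsum (I : Type) (r : seq I) (h : I -> V -> R) (x v : V)
    (dh : I -> R) :
  (forall i, is_derive x v (h i) (dh i)) ->
  is_derive x v (fun y => \sum_(i <- r) h i y) (\sum_(i <- r) dh i).
Proof.
move=> hh; rewrite -(fct_sumE r xpredT h).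
elim/big_ind2: _ => [|f df g dg|i _]; [exact: is_derive_cst|exact:
  is_deriveD|exact: hh].
Qed.

Lemma is_derive_fmul (f g : V -> R) (x v : V) (df dg : R) :
  is_derive x v f df -> is_derive x v g dg ->
  is_derive x v (fun y => f y * g y) (df * g x + f x * dg).
Proof.
move=> hf hg; have := is_deriveM hf hg; rewrite addrC.
by rewrite [g x *: _]mulrC.
Qed.

Context (m k : nat).

(** A Leibniz rule from directional derivatives alone. Induction on the number of rows of [W] that
    move: the last moving row is expanded in the standard basis, which turns its contribution into
    products of scalar functions. *)
Lemma is_derive_multilinear (T : V -> 'M[R]_(k, m) -> R) (W : V -> 'M[R]_(k, m))
    (dT : 'M[R]_(k, m) -> R) (dW : 'M[R]_(k, m)) (x v : V) :
  (\forall y \near x, multilinear_rows (T y)) ->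
  (forall A, is_derive x v (fun y => T y A) (dT A)) ->
  (forall a b, is_derive x v (fun y => W y a b) (dW a b)) ->
  is_derive x v (fun y => T y (W y))
    (dT (W x) + \sum_a T x (mxset a (row a dW) (W x))).
Proof.
move=> hT hdT.
have hTx : multilinear_rows (T x) by exact: nbhs_singleton hT.
(* [dT] inherits the expansion along a row from [T y], multilinear for [y] near [x], since the
   coefficients [A a j] are constant. *)
have dT_delta a A : dT A = \sum_j A a j * dT (mxset a (delta_mx 0 j) A).
  have [_ <-] := hdT A.
  have hj j : is_derive x v (fun y => A a j * T y (mxset a (delta_mx 0 j) A))
      (A a j * dT (mxset a (delta_mx 0 j) A)).
    have := is_derive_fmul (is_derive_cst (A a j) x v)
      (hdT (mxset a (delta_mx 0 j) A)).
    by rewrite mul0r add0r.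
  have h := is_derive_fsum (index_enum _) hj.
  rewrite -(@derive_val _ _ _ _ _ _ _ h); apply: near_eq_derive.
  apply: filterS hT => y hy; rewrite -{1}(mxset_id a A) multilinear_delta //.
  by apply: eq_bigr => j _; rewrite mxE.
(* Rows of index at least [p] are constant; for [p = k] this is no restriction. *)
suff H p : (p <= k)%N -> forall (W : V -> 'M[R]_(k, m)) (dW : 'M[R]_(k, m)),
    (forall (a : 'I_k) y, (p <= a)%N -> row a (W y) = row a (W x)) ->
    (forall a b, is_derive x v (fun y => W y a b) (dW a b)) ->
    is_derive x v (fun y => T y (W y))
      (dT (W x) + \sum_a T x (mxset a (row a dW) (W x))).
  by apply: (H k) => // a y; rewrite leqNgt ltn_ord.
elim: p => [|p IH] pk {}W {}dW hW hdW.
  have eW y : W y = W x by apply/row_matrixP => a; exact: hW.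
  rewrite big1 ?addr0 => [|a _].
    by rewrite (_ : (fun y => _) = (fun y => T y (W x))) //; apply/funext => y;
      rewrite eW.
  rewrite (_ : row a dW = 0) ?multilinear_mxset0 //.
  apply/rowP => b; rewrite !mxE; have [_ <-] := hdW a b.
  rewrite (_ : (fun y => _) = cst (W x a b)) ?derive_cst //.
  by apply/funext => y; rewrite eW.
pose a := Ordinal pk.
pose Wb j y := mxset a (delta_mx 0 j) (W y).
(* Row [a] of [Wb j] is a fixed basis vector, hence the zero row in its derivative. *)
pose dWb : 'M[R]_(k, m) := mxset a 0 dW.
have hWb j : is_derive x v (fun y => T y (Wb j y))
    (dT (Wb j x) + \sum_c T x (mxset c (row c dWb) (Wb j x))).
  apply: IH => [|c y pc|c b]; first exact: ltnW.
    rewrite !row_mxset; case: eqP => // /eqP ca; apply: hW.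
    by rewrite ltn_neqAle pc andbT eq_sym.
  rewrite /Wb /dWb /mxset mxE.
  under eq_fun do rewrite mxE.
  case: eqP => _; first by rewrite !mxE; exact: is_derive_cst.
  by under eq_fun do rewrite mxE; rewrite mxE.
have h := is_derive_fsum (index_enum _)
  (fun j => is_derive_fmul (hdW a j) (hWb j)).
apply: near_eq_is_derive (is_derive_eq h _).
  apply: filterS hT => y hy /=.
  rewrite -{2}(mxset_id a (W y)) multilinear_delta //.
  by apply: eq_bigr => j _; rewrite mxE.
rewrite big_split /= (dT_delta a (W x)) addrC.
under eq_bigr do rewrite mulrDr.
rewrite big_split /= -addrA; congr (_ + _).
rewrite [RHS](bigD1 a) //= addrC; congr (_ + _).
  rewrite multilinear_delta //.
  by apply: eq_bigr => j _; rewrite mxE.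
under eq_bigr do rewrite big_distrr /=.
rewrite exchange_big /= (bigD1 a) //= big1 ?add0r => [|j _]; last first.
  by rewrite row_mxset eqxx multilinear_mxset0 // mulr0.
apply: eq_bigr => c ca.
rewrite row_mxset (negPf ca) -{2}(mxset_id a (W x)) mxsetC //.
rewrite multilinear_delta //; apply: eq_bigr => j _.
by rewrite mxE /Wb mxsetC.
Qed.

End MultilinearDerivative.

(** The mechanism behind d d = 0: two rows can be removed in either order, with the same remaining
    matrix and opposite signs, and [h] exchanges the two orders. *)
Lemma sum_row'_cancel (R : realType) (n k : nat)
    (S : 'rV[R]_n -> 'rV[R]_n -> 'M[R]_(k, n) -> R) :
  (forall u v A, S u v A = S v u A) -> forall V : 'M[R]_(k.+2, n),
  \sum_(i < k.+2) \sum_(a < k.+1) (-1) ^+ (i + a) *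
    S (row i V) (row a (row' i V)) (row' a (row' i V)) = 0.
Proof.
move=> hS V; rewrite pair_big /=.
(* The default of [odflt] is never reached, because [lift p.1 p.2] differs from [p.1]. *)
pose h (p : 'I_k.+2 * 'I_k.+1) :=
  (lift p.1 p.2, odflt p.2 (unlift (lift p.1 p.2) p.1)).
have hE i a : lift (h (i, a)).1 (h (i, a)).2 = i.
  rewrite /h /=; have /unlift_some[b eb ->] : lift i a != i.
    by rewrite eq_sym neq_lift.
  by rewrite /= -eb.
have hval i a : val (h (i, a)).2 = if (a < i)%N then i.-1 else i.
  have /(congr1 val) /= := hE i a; rewrite /bump.
  by case: (ltnP a i); case: leqP; case: leqP; lia.
have hK : involutive h.
  move=> [i a]; have e1 := hE i a.
  have e2 : (h (h (i, a))).1 = i by rewrite -[RHS]e1.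
  have := hE (h (i, a)).1 (h (i, a)).2.
  rewrite -surjective_pairing e2 => /lift_inj e3.
  by rewrite [LHS]surjective_pairing e2 e3.
set s := (X in X = 0).
suff : s = - s by move=> e; lra.
rewrite {1}/s (reindex_inj (inv_inj hK)) /= -sumrN; apply: eq_bigr => -[i a] _.
have hi : row (lift (h (i, a)).1 (h (i, a)).2) V = row i V by rewrite hE.
rewrite !row_rowsub in hi *.
rewrite hi hS -mulNr; congr (_ * _).
  rewrite -[RHS]mulN1r -exprS hval /h /= /bump -[LHS]signr_odd -[RHS]signr_odd;
    congr (_ ^+ nat_of_bool _).
  by case: (ltnP a i) => ? /=; lia.
congr (S _ _ _); apply/row_matrixP => c; rewrite !row_rowsub; congr (row _ V).
apply: val_inj; rewrite /= hval /bump /=.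
by case: (ltnP a i); lia.
Qed.

Section ConsRow.
Context (R : nzRingType) (n : nat).

Lemma row0_col_mx k (u : 'rV[R]_n) (V : 'M[R]_(k, n)) :
  row ord0 (col_mx u V : 'M[R]_(k.+1, n)) = u.
Proof.
have e : ord0 = @lshift 1 k ord0 :> 'I_(1 + k) by exact: val_inj.
by rewrite e (@rowKu _ 1 k) row_id.
Qed.

Lemma rowS_col_mx k (u : 'rV[R]_n) (V : 'M[R]_(k, n)) i :
  row (lift ord0 i) (col_mx u V : 'M[R]_(k.+1, n)) = row i V.
Proof.
have e : lift ord0 i = @rshift 1 k i :> 'I_(1 + k) by exact: val_inj.
by rewrite e (@rowKd _ 1 k).
Qed.

Lemma row0_col_mxE k (u : 'rV[R]_n) (V : 'M[R]_(k, n)) j :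
  (col_mx u V : 'M[R]_(k.+1, n)) ord0 j = u 0 j.
Proof. by have /rowP/(_ j) := row0_col_mx u V; rewrite mxE. Qed.

Lemma rowS_col_mxE k (u : 'rV[R]_n) (V : 'M[R]_(k, n)) i j :
  (col_mx u V : 'M[R]_(k.+1, n)) (lift ord0 i) j = V i j.
Proof. by have /rowP/(_ j) := rowS_col_mx u V i; rewrite mxE [in RHS]mxE. Qed.

Lemma col_mx_row_matrixP k (A B : 'M[R]_(k.+1, n)) :
  row ord0 A = row ord0 B ->
  (forall i, row (lift ord0 i) A = row (lift ord0 i) B) -> A = B.
Proof.
by move=> h0 hS; apply/row_matrixP => i; case: (unliftP ord0 i) => [j ->|->].
Qed.

Lemma row'0_col_mx k (u : 'rV[R]_n) (V : 'M[R]_(k, n)) :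
  row' ord0 (col_mx u V : 'M[R]_(k.+1, n)) = V.
Proof. by apply/row_matrixP => j; rewrite row_rowsub rowS_col_mx. Qed.

Lemma row'S_col_mx k (u : 'rV[R]_n) (V : 'M[R]_(k.+1, n)) i :
  row' (lift ord0 i) (col_mx u V : 'M[R]_(k.+2, n)) = col_mx u (row' i V).
Proof.
apply: col_mx_row_matrixP => [|j]; rewrite row_rowsub.
  rewrite row0_col_mx (_ : lift _ _ = ord0) ?row0_col_mx //; exact: val_inj.
rewrite rowS_col_mx row_rowsub.
rewrite (_ : lift _ _ = lift ord0 (lift i j)) ?rowS_col_mx //; apply: val_inj.
by rewrite /= /bump; lia.
Qed.

End ConsRow.

Section Cartan.
Context (R : realType) (n : nat).

Lemma lext_near (k : nat) (w t : lfield R R n k) x :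
  (forall V, \forall y \near x, w y V = t y V) -> lext w x = lext t x.
Proof.
move=> e; apply/funext => V; apply: eq_bigr => i _; congr (_ * _).
exact: near_eq_derive.
Qed.

Lemma is_derive_liprod (k : nat) (w : lfield R R n k.+1)
    (X : 'rV[R]_n -> 'rV[R]_n) (x v dX : 'rV[R]_n) (V : 'M[R]_(k, n)) :
  (\forall y \near x, multilinear_rows (w y)) ->
  (forall V, derivable (w^~ V) x v) ->
  (forall b, is_derive x v (fun y => X y 0 b) (dX 0 b)) ->
  is_derive x v (fun y => liprod X w y V)
    ('D_v (fun y => w y (col_mx (X x) V)) x + w x (col_mx dX V)).
Proof.
move=> hw dw hX.
pose W y : 'M[R]_(k.+1, n) := col_mx (X y) V.
have := @is_derive_multilinear R _ n k.+1 w W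
  (fun A => 'D_v (fun y => w y A) x) (col_mx dX (0 : 'M[R]_(k, n))) x v hw.
move=> /(_ (fun A => derivableP (dw A))).
rewrite big_ord_recl big1 ?addr0 => [|a _].
  rewrite row0_col_mx mxset_col_mx; apply => a b.
  rewrite /W; case: (unliftP ord0 a) => [j ->|->].
    rewrite rowS_col_mxE mxE; under eq_fun do rewrite rowS_col_mxE.
    exact: is_derive_cst.
  by rewrite row0_col_mxE; under eq_fun do rewrite row0_col_mxE.
rewrite rowS_col_mx row0 multilinear_mxset0 //.
exact: nbhs_singleton hw.
Qed.

(** In i_X d w, row 0 gives the derivative of w along X and the other rows cancel against d i_X w.
    The derivatives of X that remain are the correction terms of [llie]. *)
Lemma llie_cartan (k : nat) (w : lfield R R n k.+1) (X : 'rV[R]_n -> 'rV[R]_n) x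
  :
  (\forall y \near x, multilinear_rows (w y)) -> antisym_rows (w x) ->
  (forall V v, derivable (w^~ V) x v) ->
  (forall v, derivable X x v) ->
  forall V, llie X w x V = lext (liprod X w) x V + liprod X (lext w) x V.
Proof.
move=> hw ha dw dX V.
have dXb v b : is_derive x v (fun y => X y 0 b) (('D_v X x) 0 b).
  apply: DeriveDef; first exact: (derivable_mxP X x v).1.
  by rewrite derive_mx // mxE.
rewrite /llie /lext {2}/liprod [X in _ = _ + X]big_ord_recl /= expr0 mul1r.
rewrite row0_col_mx row'0_col_mx addrCA; congr (_ + _).
rewrite -big_split /=; apply: eq_bigr => i _.
have [_ ->] := is_derive_liprod (row' i V) hw (dw^~ (row i V)) (dXb (row i V)).
rewrite rowS_col_mx row'S_col_mx -[X in w x X]/(mxset i _ V) antisym_mxset //.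
by rewrite mulrDr exprS mulN1r mulNr addrAC subrr add0r.
Qed.

End Cartan.

Lemma row'_mul (R : pzRingType) (k m n : nat) (i : 'I_k) (A : 'M[R]_(k, m))
    (B : 'M[R]_(m, n)) : row' i (A *m B) = row' i A *m B.
Proof. by apply/row_matrixP => j; rewrite row_mul !row_rowsub row_mul. Qed.

Definition lpullback (R : realType) (m n k : nat) (phi : 'rV[R]_m -> 'rV[R]_n)
    (t : lfield R R n k) : lfield R R m k :=
  fun y V => t (phi y) (V *m 'J phi y).

(** The chain rule produces derivatives of [t], which make up the pullback of d t, and second
    derivatives of [phi], which cancel in pairs by [sym]. *)
Lemma lext_pullback (R : realType) (m n k : nat) (phi : 'rV[R]_m -> 'rV[R]_n)
    (t : lfield R R n k.+1) x :
  (\forall y \near x, differentiable phi y) ->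
  (forall u v, derivable (fun y => 'D_u phi y) x v) ->
  (forall u v, 'D_u (fun y => 'D_v phi y) x = 'D_v (fun y => 'D_u phi y) x) ->
  (\forall y \near phi x, multilinear_rows (t y)) -> antisym_rows (t (phi x)) ->
  (forall V, differentiable (t^~ V) (phi x)) ->
  forall V, lext (lpullback phi t) x V = lpullback phi (lext t) x V.
Proof.
move=> dphi ddphi sym ht ha dt V.
have dphix : differentiable phi x by exact: nbhs_singleton dphi.
have ht' : \forall y \near x, multilinear_rows (t (phi y)).
  have c := differentiable_continuous dphix.
  exact: (c _ ht).
have dJ (v : 'rV[R]_m) (A : 'M[R]_(k.+1, m)) (a : 'I_k.+1) (b : 'I_n) :
    is_derive x v (fun y => (A *m 'J phi y) a b)
      ((\matrix_a 'D_v (fun y => 'D_(row a A) phi y) x) a b).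
  have h : is_derive x v (fun y => ('D_(row a A) phi y) 0 b)
      ('D_v (fun y => 'D_(row a A) phi y) x 0 b).
    apply: DeriveDef; first exact: (derivable_mxP _ x v).1.
    by rewrite derive_mx // mxE.
  rewrite mxE; apply: near_eq_is_derive h.
  apply: filterS dphi => y dy.
  by rewrite deriveEjacobian // -row_mul mxE.
have dtphi (v : 'rV[R]_m) A :
    is_derive x v (fun y => t (phi y) A) ('D_(v *m 'J phi x) (t^~ A) (phi x)).
  have d : differentiable ((t^~ A) \o phi) x by exact: differentiable_comp.
  apply: DeriveDef; first exact: diff_derivable.
  by rewrite (deriveE _ d) diff_comp //= -!deriveE // deriveEjacobian.
rewrite /lpullback /lext.
transitivity (\sum_(i < k.+2) ((-1) ^+ i *
    'D_(row i (V *m 'J phi x)) (t^~ (row' i (V *m 'J phi x))) (phi x) +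
    \sum_(a < k.+1) (-1) ^+ (i + a) *
      t (phi x) (col_mx ('D_(row i V) (fun y => 'D_(row a (row' i V)) phi y) x)
        (row' a (row' i V) *m 'J phi x)))).
  apply: eq_bigr => i _.
  have [_ ->] := is_derive_multilinear ht' (dtphi (row i V)) (dJ (row i V) (row'
    i V)).
  rewrite mulrDr row_mul row'_mul; congr (_ + _).
  rewrite big_distrr /=; apply: eq_bigr => a _.
  by rewrite antisym_mxset // mulrA -exprD rowK row'_mul.
rewrite big_split /= [X in _ + X](_ : _ = 0) ?addr0 //.
pose S u v (A : 'M[R]_(k, m)) := t (phi x)
  (col_mx ('D_u (fun y => 'D_v phi y) x) (A *m 'J phi x)).
have hS u v A : S u v A = S v u A by rewrite /S sym.
exact: (sum_row'_cancel hS V).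
Qed.

(** * Symmetry of second derivatives *)

Section SecondDerivative.
Context (R : realType) (V : normedModType R).
Implicit Types (f : V -> R) (x u v : V).

Lemma is_derive_line f (c u : V) (s d : R) :
  is_derive (c + s *: u) u f d -> is_derive s (1 : R) (fun s => f (c + s *: u))
    d.
Proof.
have e : (fun h : R => h^-1 *: ((fun s => f (c + s *: u)) (h *: 1 + s) - f (c +
  s *: u))) =
    (fun h : R => h^-1 *: (f (h *: u + (c + s *: u)) - f (c + s *: u))).
  apply/funext => h; congr (_ *: (f _ - _)).
  by rewrite [h *: 1]mulr1 scalerDl addrCA.
by move=> [h1 h2]; split; [rewrite /derivable e | rewrite /derive e].
Qed.

(* Mean value theorem for [s |-> f (x + t v + s u) - f (x + s u)] on [0, t]. *)
Lemma second_difference f x u v :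
  (\forall y \near x, derivable f y u) -> differentiable ('D_u f) x ->
  forall e, 0 < e -> exists2 r, 0 < r & forall t, 0 < t < r ->
  `|f (x + t *: u + t *: v) - f (x + t *: u) - f (x + t *: v) + f x
    - t ^+ 2 * 'D_v ('D_u f) x| <= e * t ^+ 2.
Proof.
move=> df ddf e e0.
(* [t * K] bounds the total size of the displacements [s *: u] and [s *: u + t *: v] for [s] at most
   [t]; the summand 1 keeps [K] positive. *)
pose K := 2 * `|u| + `|v| + 1.
have K0 : 0 < K by rewrite /K ltr_wpDl // addr_ge0 // mulr_ge0.
have eK : 0 < e / K by rewrite divr_gt0.
have /eqaddoP/(_ _ eK) dd := diff_locally ddf.
have df0 : \forall h \near (0 : V), derivable f (h + x) u.
  by have := df; rewrite (near_shift 0) /= subr0.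
have [r /= r0 hr] := (nbhs_ballP _ _).1 (filterI dd df0).
have {}hr h : `|h| < r ->
    `|'D_u f (x + h) - 'D_u f x - 'd ('D_u f) x h| <= e / K * `|h| /\
    derivable f (x + h) u.
  move=> hh; have [] := hr h; first by rewrite -ball_normE /= sub0r normrN.
  move=> h1 h2; split; last by rewrite addrC.
  by move: h1; rewrite opprD addrA !fctE /= [h + x]addrC.
exists (r / K) => [|t /andP[t0 tr]]; first by rewrite divr_gt0.
have tK : t * K < r by rewrite -ltr_pdivlMr.
have small s : 0 <= s <= t -> `|s *: u| + `|s *: u + t *: v| <= t * K.
  move=> /andP[s0 st]; apply: le_trans (lerD (lexx _) (ler_normD _ _)) _.
  rewrite !normrZ (ger0_norm s0) (gtr0_norm t0) /K.
  have := ler_wpM2r (normr_ge0 u) st; have := normr_ge0 v; nra.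
pose g s := f (x + t *: v + s *: u) - f (x + s *: u).
pose dg s := 'D_u f (x + t *: v + s *: u) - 'D_u f (x + s *: u).
have hg s : 0 <= s <= t -> is_derive s (1 : R) g (dg s).
  move=> hs; have := small s hs => hs'.
  have d1 : derivable f (x + t *: v + s *: u) u.
    rewrite -addrA; apply: (hr _ _).2; rewrite [_ *: v + _]addrC.
    by apply: le_lt_trans tK; apply: le_trans hs'; rewrite lerDr.
  have d2 : derivable f (x + s *: u) u.
    by apply: (hr _ _).2; apply: le_lt_trans tK; apply: le_trans hs'; rewrite
      lerDl.
  exact: (is_deriveB (is_derive_line (derivableP d1)) (is_derive_line
    (derivableP d2))).
have [c ct eg] : exists2 c, c \in `]0, t[%R & g t - g 0 = dg c * (t - 0).
  apply: MVT => //.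
    by move=> s; rewrite in_itv /= => /andP[s0 st]; apply: hg; rewrite !ltW.
  apply: derivable_within_continuous => s; rewrite in_itv /= => hs.
  by have [] := hg s hs.
have hc : 0 <= c <= t by move: ct; rewrite in_itv /= => /andP[/ltW -> /ltW ->].
have -> : f (x + t *: u + t *: v) - f (x + t *: u) - f (x + t *: v) + f x =
    t * dg c.
  move: eg; rewrite /g !scale0r !addr0 subr0 mulrC => <-.
  by rewrite [x + t *: u + _]addrAC; ring.
have -> : 'D_v ('D_u f) x = 'd ('D_u f) x v by rewrite deriveE.
rewrite expr2 -mulrA -mulrBr normrM (gtr0_norm t0) mulrCA ler_pM2l //.
have hs := small c hc.
have h1 : `|c *: u| < r.
  by apply: le_lt_trans tK; apply: le_trans hs; rewrite lerDl.
have h2 : `|c *: u + t *: v| < r.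
  by apply: le_lt_trans tK; apply: le_trans hs; rewrite lerDr.
have [b1 _] := hr _ h1; have [b2 _] := hr _ h2.
(* By linearity the main term is a difference of differentials at the two displacements, so the
   error splits into two first-order remainders. *)
have eL : t * 'd ('D_u f) x v =
    'd ('D_u f) x (c *: u + t *: v) - 'd ('D_u f) x (c *: u).
  by rewrite linearD /= addrC addKr linearZ.
have -> : dg c - t * 'd ('D_u f) x v =
   ('D_u f (x + (c *: u + t *: v)) - 'D_u f x - 'd ('D_u f) x (c *: u + t *: v))
   - ('D_u f (x + c *: u) - 'D_u f x - 'd ('D_u f) x (c *: u)).
  by rewrite eL /dg [x + t *: v + _]addrAC -[x + _ + t *: v]addrA; ring.
apply: le_trans (ler_normB _ _) _; apply: le_trans (lerD b2 b1) _.
rewrite -mulrDr [_ + `|c *: u|]addrC mulrC -ler_pdivlMr //.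
have -> : e * t / (e / K) = t * K by field; rewrite !gt_eqF.
exact: hs.
Qed.

(** Young's version of the theorem: the second difference is symmetric in [u] and [v] and
    approximates t^2 times each iterated derivative, so the two differ by at most any positive
    [e]. *)
Lemma derive_comm f x u v :
  (\forall y \near x, differentiable f y) ->
  differentiable ('D_u f) x -> differentiable ('D_v f) x ->
  'D_u ('D_v f) x = 'D_v ('D_u f) x.
Proof.
move=> df du dv; apply/eqP; rewrite -subr_eq0 -normr_eq0; apply/eqP.
apply/le_anti; rewrite normr_ge0 andbT; apply/ler_addgt0Pl => e e0.
have dfu w : \forall y \near x, derivable f y w.
  by apply: filterS df => y; exact: diff_derivable.
have e2 : 0 < e / 2 by rewrite divr_gt0.
have [r1 r10 h1] := second_difference v (dfu u) du e2.
have [r2 r20 h2] := second_difference u (dfu v) dv e2.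
pose t := Num.min r1 r2 / 2.
have m0 : 0 < Num.min r1 r2 by rewrite lt_min r10.
have t0 : 0 < t by rewrite divr_gt0.
have tm : t < Num.min r1 r2 by rewrite /t; lra.
have {}h1 := h1 t; have {}h2 := h2 t; move: tm; rewrite lt_min => /andP[t1 t2].
rewrite t0 t1 in h1; rewrite t0 t2 in h2.
have {}h1 := h1 isT; have {}h2 := h2 isT.
rewrite addr0 -(ler_pM2r (exprn_gt0 2 t0)) -[t ^+ 2 in X in X <= _]gtr0_norm
  ?exprn_gt0 //.
rewrite -normrM.
set A := f (x + t *: u + t *: v) in h1.
rewrite [x + _ + _]addrAC -/A in h2.
move: ('D_u ('D_v f) x) ('D_v ('D_u f) x) h1 h2 => P Q h1 h2.
clearbody A t.
have -> : (P - Q) * t ^+ 2 =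
  (A - f (x + t *: u) - f (x + t *: v) + f x - t ^+ 2 * Q)
  - (A - f (x + t *: v) - f (x + t *: u) + f x - t ^+ 2 * P) by ring.
apply: le_trans (ler_normB _ _) _; apply: le_trans (lerD h1 h2) _.
by rewrite -mulrDl -splitr.
Qed.

End SecondDerivative.

(** * Smoothness of wedge products *)

Section Smooth.
Context (R : realType) (m : nat).
Implicit Types (A : set 'rV[R]_m).

(** The difference vanishes near [x], hence is differentiable there with differential 0. *)
Lemma near_eq_differentiable (V W : normedModType R) (f g : V -> W) x :
  {near x, f =1 g} -> differentiable f x -> differentiable g x.
Proof.
move=> fg df; rewrite -[g](subrK f); apply: differentiableD => //.
pose h := g - f.
have h0 : \forall y \near 0, h (y + x) = 0.
  have h' : \forall y \near x, h y = 0.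
    apply: filterS fg => y e; have -> : h y = g y - f y by [].
    by rewrite (e : f y = g y) subrr.
  by have := h'; rewrite (near_shift 0) /= subr0.
have hx : h x = 0 by have := nbhs_singleton h0; rewrite add0r.
have ho : h \o shift x = cst (h x) + \0 +o_ 0 id.
  apply/eqaddoP => e e0; apply: filterS h0 => y hy.
  have -> : (h \o shift x - (cst (h x) + \0)) y = h (y + x) - (h x + 0) by [].
  by rewrite hy hx addr0 subr0 normr0 mulr_ge0 // ltW.
have d0 : 'd h x = \0 :> (V -> W).
  by apply: diff_unique ho; exact: cst_continuous.
by apply/diff_locallyP; rewrite d0; split=> //; exact: cst_continuous.
Qed.

Lemma Ck_ext (W : normedModType R) k (f g : 'rV[R]_m -> W) A : open A ->
  (forall x, A x -> f x = g x) -> Ck k f A -> Ck k g A.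
Proof.
move=> oA; elim: k f g => [|k IH] f g fg /=.
  move=> hf x Ax; have := hf x Ax.
  have n : \forall y \near x, f y = g y.
    by apply: filterS (open_nbhs_nbhs (conj oA Ax)) => y; exact: fg.
  rewrite /prop_for /continuous_at (fg x Ax); apply: cvg_trans.
  exact: (@near_eq_cvg _ _ (nbhs x) _ _ _ n).
have n x : A x -> \forall y \near x, f y = g y.
  by move=> Ax; apply: filterS (open_nbhs_nbhs (conj oA Ax)) => y; exact: fg.
move=> [df hf]; split=> [x Ax|v].
  by apply: near_eq_differentiable (df x Ax); exact: n.
by apply: IH (hf v) => x Ax; apply: near_eq_derive; exact: n.
Qed.

Lemma CkW (W : normedModType R) k (f : 'rV[R]_m -> W) A : Ck k.+1 f A -> Ck k f
  A.
Proof.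
elim: k f => [|k IH] f [df hf]; first by move=> x Ax; exact:
  differentiable_continuous (df x Ax).
by split=> // v; exact: (IH ('D_v f) (hf v)).
Qed.

Lemma Ck_cst k (c : R) A : Ck k (fun=> c) A.
Proof.
elim: k c => [|k IH] c /=; first by move=> x _; exact: cst_continuous.
split=> [x _|v]; first exact: differentiable_cst.
have -> : (fun x => 'D_v (fun=> c) x) = (fun=> 0) :> ('rV[R]_m -> R).
  by apply/funext => x; rewrite derive_cst.
exact: (IH 0).
Qed.

Lemma CkD k (f g : 'rV[R]_m -> R) A : open A ->
  Ck k f A -> Ck k g A -> Ck k (f + g) A.
Proof.
move=> oA; elim: k f g => [|k IH] f g /=.
  by move=> hf hg x Ax; apply: continuousD; [exact: hf|exact: hg].
move=> [df hf] [dg hg]; split=> [x Ax|v].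
  by apply: differentiableD; [exact: df|exact: dg].
apply: Ck_ext (IH _ _ (hf v) (hg v)) => // x Ax; rewrite deriveD //.
- exact: diff_derivable (df x Ax).
- exact: diff_derivable (dg x Ax).
Qed.

Lemma CkM k (f g : 'rV[R]_m -> R) A : open A ->
  Ck k f A -> Ck k g A -> Ck k (f * g) A.
Proof.
move=> oA; elim: k f g => [|k IH] f g /=.
  by move=> hf hg x Ax; apply: continuousM; [exact: hf|exact: hg].
move=> hf hg; have [df hf'] := hf; have [dg hg'] := hg.
split=> [x Ax|v].
  by apply: differentiableM; [exact: df|exact: dg].
have h := CkD oA (IH _ _ (CkW hf) (hg' v)) (IH _ _ (CkW hg) (hf' v)).
apply: Ck_ext h => // x Ax; rewrite deriveM //.
- exact: diff_derivable (df x Ax).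
- exact: diff_derivable (dg x Ax).
Qed.

Lemma Ck_sum k (I : Type) (r : seq I) (P : pred I) (f : I -> 'rV[R]_m -> R) A :
  open A ->
  (forall i, Ck k (f i) A) -> Ck k (fun x => \sum_(i <- r | P i) f i x) A.
Proof.
move=> oA hf; rewrite -(fct_sumE r P f).
elim/big_ind: _ => //; first exact: Ck_cst.
by move=> ? ?; exact: CkD.
Qed.

End Smooth.

Section WedgeForm.
Context (R : realType) (n : nat) (N : manifold R n).

Lemma is_form_antisym (k : nat) (w : tfield N k) i x :
  is_form w -> cimg i x -> antisym_rows (w i x).
Proof.
by case=> _ hm ha _ hx; apply: antisym_alternating; [exact: hm|exact: ha].
Qed.

Lemma wedge_form (k l : nat) (a : tfield N k) (b : tfield N l) :
  is_form a -> is_form b -> is_form (a \wedge b).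
Proof.
move=> [as1 am aa at1] [bs bm ba bt]; split.
- move=> i V p; have oc : open (@cimg _ _ N i) by exact: open_cimg.
  rewrite /wedge /lwedge.
  apply: (CkM (f := fun=> _) (g := fun x => \sum_s _)) => //; first exact:
    Ck_cst.
  apply: Ck_sum => // s.
  apply: (CkM (f := fun=> _) (g := fun x => _ * _)) => //; first exact: Ck_cst.
  by apply: CkM => //; [exact: as1|exact: bs].
- by move=> i x hx; apply: lwedge_multilinear; [exact: am|exact: bm].
- by move=> i x hx; apply: alternating_antisym; exact: lwedge_antisym.
- move=> i j q hi hj V; rewrite /wedge /lwedge; congr (_ * _).
  apply: eq_bigr => s _; congr (_ * (_ * _)).
    by rewrite (at1 i j) //; congr (a j _ _); apply/matrixP => r c; rewrite
      !mxE; apply: eq_bigr => d _; rewrite !mxE.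
  by rewrite (bt i j) //; congr (b j _ _); apply/matrixP => r c; rewrite !mxE;
    apply: eq_bigr => d _; rewrite !mxE.
Qed.

End WedgeForm.

(** * The action of SU(3) on adapted coframes *)

Section SU3Algebra.
Context (R : realType).
Implicit Types (u v w z : 'rV[R]_6) (E : 'rV[R]_6 -> 'rV[R]_6).

(* [u 0 k] stands for f^(k+1)(u), the frame being indexed from 0. *)
Definition minor2 (a b : 'I_6) u v : R := u 0 a * v 0 b - u 0 b * v 0 a.

Definition minor3 (a b c : 'I_6) u v w : R :=
  minor2 a b u v * w 0 c - minor2 a b u w * v 0 c + minor2 a b v w * u 0 c.

Definition su3_F u v : R := minor2 0 1 u v + minor2 2 3 u v + minor2 4 5 u v.

Definition su3_re u v w : R :=
  minor3 0 2 4 u v w - minor3 0 3 5 u v w - minor3 1 2 5 u v w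
  - minor3 1 3 4 u v w.

Definition su3_im u v w : R :=
  minor3 0 2 5 u v w + minor3 0 3 4 u v w + minor3 1 2 4 u v w
  - minor3 1 3 5 u v w.

Definition su3_dot u v : R :=
  u 0 0 * v 0 0 + u 0 1 * v 0 1 + u 0 2 * v 0 2
  + u 0 3 * v 0 3 + u 0 4 * v 0 4 + u 0 5 * v 0 5.

Definition su3_preserving (T : 'rV[R]_6 -> 'rV[R]_6) : Prop :=
  [/\ forall u v, su3_F (T u) (T v) = su3_F u v,
      forall u v w, su3_re (T u) (T v) (T w) = su3_re u v w,
      forall u v w, su3_im (T u) (T v) (T w) = su3_im u v w &
      forall u v, su3_dot (T u) (T v) = su3_dot u v].

(* the action of the matrix [[a, b], [- conj b, conj a]] on the first two
   complex coordinates, where a = a1 + i a2 and b = b1 + i b2 *)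
Definition su2_rot (a1 a2 b1 b2 : R) u : 'rV[R]_6 :=
  \row_j [:: a1 * u 0 0 - a2 * u 0 1 + b1 * u 0 2 - b2 * u 0 3;
             a1 * u 0 1 + a2 * u 0 0 + b1 * u 0 3 + b2 * u 0 2;
             - b1 * u 0 0 - b2 * u 0 1 + a1 * u 0 2 + a2 * u 0 3;
             - b1 * u 0 1 + b2 * u 0 0 + a1 * u 0 3 - a2 * u 0 2;
             u 0 4; u 0 5]`_j.

(** (z_1, z_2, z_3) goes to (z_3, z_1, z_2), an even permutation of the complex coordinates, hence
    of determinant 1. *)
Definition cycle_coord u : 'rV[R]_6 :=
  \row_j [:: u 0 4; u 0 5; u 0 0; u 0 1; u 0 2; u 0 3]`_j.

Lemma row6P u v : u 0 0 = v 0 0 -> u 0 1 = v 0 1 -> u 0 2 = v 0 2 ->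
  u 0 3 = v 0 3 -> u 0 4 = v 0 4 -> u 0 5 = v 0 5 -> u = v.
Proof.
move=> h0 h1 h2 h3 h4 h5; apply/rowP => -[k hk].
move: h0 h1 h2 h3 h4 h5; case: k hk => [|[|[|[|[|[|//]]]]]] hk.
- by move=> + _ _ _ _ _; congr (u 0 _ = v 0 _); exact: val_inj.
- by move=> _ + _ _ _ _; congr (u 0 _ = v 0 _); exact: val_inj.
- by move=> _ _ + _ _ _; congr (u 0 _ = v 0 _); exact: val_inj.
- by move=> _ _ _ + _ _; congr (u 0 _ = v 0 _); exact: val_inj.
- by move=> _ _ _ _ + _; congr (u 0 _ = v 0 _); exact: val_inj.
- by move=> _ _ _ _ _ +; congr (u 0 _ = v 0 _); exact: val_inj.
Qed.

(** The inverse of a unitary matrix is its conjugate transpose: here a becomes conj a and b becomes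
    - b. *)
Lemma su2_rotK (a1 a2 b1 b2 : R) : a1 ^+ 2 + a2 ^+ 2 + b1 ^+ 2 + b2 ^+ 2 = 1 ->
  cancel (su2_rot a1 (- a2) (- b1) (- b2)) (su2_rot a1 a2 b1 b2).
Proof.
move=> n1 u; apply: row6P; rewrite /su2_rot !mxE /= ?mxE //=.
- by rewrite -[RHS]mul1r -n1; ring.
- by rewrite -[RHS]mul1r -n1; ring.
- by rewrite -[RHS]mul1r -n1; ring.
- by rewrite -[RHS]mul1r -n1; ring.
Qed.

(** The determinant |a|^2 + |b|^2 comes out as a factor of every term that involves the first two
    complex coordinates. Inserting it before using [n1] leaves polynomial identities. *)
Lemma su2_rot_preserving (a1 a2 b1 b2 : R) :
  a1 ^+ 2 + a2 ^+ 2 + b1 ^+ 2 + b2 ^+ 2 = 1 ->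
  su3_preserving (su2_rot a1 a2 b1 b2).
Proof.
move=> n1; split=> [u v|u v w|u v w|u v].
- rewrite /su3_F /minor2 /su2_rot !mxE /=.
  transitivity ((a1 ^+ 2 + a2 ^+ 2 + b1 ^+ 2 + b2 ^+ 2) *
    (minor2 0 1 u v + minor2 2 3 u v) + minor2 4 5 u v).
    by rewrite /minor2; ring.
  by rewrite n1 mul1r.
- rewrite -[RHS]mul1r -n1 /su3_re /minor3 /minor2 /su2_rot !mxE /=; ring.
- rewrite -[RHS]mul1r -n1 /su3_im /minor3 /minor2 /su2_rot !mxE /=; ring.
- rewrite /su3_dot /su2_rot !mxE /=.
  transitivity ((a1 ^+ 2 + a2 ^+ 2 + b1 ^+ 2 + b2 ^+ 2) *
    (u 0 0 * v 0 0 + u 0 1 * v 0 1 + u 0 2 * v 0 2 + u 0 3 * v 0 3)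
    + u 0 4 * v 0 4 + u 0 5 * v 0 5).
    by ring.
  by rewrite n1 mul1r.
Qed.

Lemma cycle_coord_preserving : su3_preserving cycle_coord.
Proof.
split=> [u v|u v w|u v w|u v].
- by rewrite /su3_F /minor2 /cycle_coord !mxE /=; ring.
- by rewrite /su3_re /minor3 /minor2 /cycle_coord !mxE /=; ring.
- by rewrite /su3_im /minor3 /minor2 /cycle_coord !mxE /=; ring.
- by rewrite /su3_dot /cycle_coord !mxE /=; ring.
Qed.

Lemma su2_rot_normalize u : exists a1 a2 b1 b2 : R,
  a1 ^+ 2 + a2 ^+ 2 + b1 ^+ 2 + b2 ^+ 2 = 1 /\
  let v := su2_rot a1 a2 b1 b2 u in
  [/\ 0 <= v 0 0, v 0 1 = 0, v 0 2 = 0, v 0 3 = 0 &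
      v 0 4 = u 0 4 /\ v 0 5 = u 0 5].
Proof.
pose s := u 0 0 ^+ 2 + u 0 1 ^+ 2 + u 0 2 ^+ 2 + u 0 3 ^+ 2.
have s0 : 0 <= s by rewrite /s !addr_ge0 ?sqr_ge0.
pose r := Num.sqrt s.
have r2 : r ^+ 2 = s by rewrite sqr_sqrtr.
have r0 : 0 <= r by exact: sqrtr_ge0.
have [re|rn] := eqVneq r 0.
  have : s = 0 by rewrite -r2 re expr0n.
  have := sqr_ge0 (u 0 0); have := sqr_ge0 (u 0 1).
  have := sqr_ge0 (u 0 2); have := sqr_ge0 (u 0 3); rewrite /s => p3 p2 p1 p0 e.
  have e0 : u 0 0 = 0 by apply/eqP; rewrite -sqrf_eq0; apply/eqP; lra.
  have e1 : u 0 1 = 0 by apply/eqP; rewrite -sqrf_eq0; apply/eqP; lra.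
  have e2 : u 0 2 = 0 by apply/eqP; rewrite -sqrf_eq0; apply/eqP; lra.
  have e3 : u 0 3 = 0 by apply/eqP; rewrite -sqrf_eq0; apply/eqP; lra.
  exists 1, 0, 0, 0; split; first by ring.
  by rewrite /su2_rot !mxE /= e0 e1 e2 e3 !(mul0r, mulr0, addr0, subr0, oppr0).
(* With z_1, z_2 the first two complex coordinates, a = conj z_1 / r and b = conj z_2 / r send (z_1,
   z_2) to (r, 0). *)
exists (u 0 0 / r), (- u 0 1 / r), (u 0 2 / r), (- u 0 3 / r); split.
  transitivity (s / r ^+ 2); first by rewrite /s; field.
  by rewrite r2 divff // -r2 expf_neq0.
rewrite /su2_rot !mxE /=; split; last by [].
- have -> : u 0 0 / r * u 0 0 - - u 0 1 / r * u 0 1 + u 0 2 / r * u 0 2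
    - - u 0 3 / r * u 0 3 = s / r by rewrite /s; field.
  by rewrite divr_ge0.
- by field.
- by field.
- by field.
Qed.

(** [E u] lists the coframe values on [u]. Besides the normal forms only surjectivity is recorded,
    since the later arguments work with the coordinates of the images. *)
Definition su3_coframe E (F : 'M[R]_(2, 6) -> R) (Psip Psim : 'M[R]_(3, 6) -> R)
    (g : 'M[R]_(2, 6) -> R) : Prop :=
  [/\ forall w, exists u, E u = w,
      forall u v, F (mxrows 2 [:: u; v]) = su3_F (E u) (E v),
      forall u v w, Psip (mxrows 3 [:: u; v; w]) = su3_re (E u) (E v) (E w),
      forall u v w, Psim (mxrows 3 [:: u; v; w]) = su3_im (E u) (E v) (E w) &
      forall u v, g (mxrows 2 [:: u; v]) = su3_dot (E u) (E v)].

Lemma su3_coframe_comp E T F Psip Psim g : su3_preserving T ->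
  (forall w, exists u, T u = w) ->
  su3_coframe E F Psip Psim g -> su3_coframe (T \o E) F Psip Psim g.
Proof.
move=> [TF Tre Tim Tdot] sT [sE hF hre him hg]; split=> [w|||| ] /=.
- by have [u' <-] := sT w; have [u <-] := sE u'; exists u.
- by move=> u v; rewrite TF.
- by move=> u v w; rewrite Tre.
- by move=> u v w; rewrite Tim.
- by move=> u v; rewrite Tdot.
Qed.

(* SU(3) acts transitively on spheres: two rotations, the second one conjugated
   by a cyclic permutation of the complex coordinates, move a vector to a
   nonnegative multiple of the first one. *)
Lemma su3_coframe_along E F Psip Psim g u : su3_coframe E F Psip Psim g ->
  exists E' r, [/\ su3_coframe E' F Psip Psim g, 0 <= r &
                   E' u = r *: delta_mx 0 0].
Proof.
move=> hE.
have rot E1 : su3_coframe E1 F Psip Psim g -> exists T,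
    su3_coframe (T \o E1) F Psip Psim g /\
    [/\ 0 <= T (E1 u) 0 0, T (E1 u) 0 1 = 0, T (E1 u) 0 2 = 0,
        T (E1 u) 0 3 = 0 & T (E1 u) 0 4 = E1 u 0 4 /\ T (E1 u) 0 5 = E1 u 0 5].
  move=> h1; have [a1 [a2 [b1 [b2 [n1 hv]]]]] := su2_rot_normalize (E1 u).
  exists (su2_rot a1 a2 b1 b2); split=> //.
  apply: su3_coframe_comp => //; first exact: su2_rot_preserving.
  by move=> w; exists (su2_rot a1 (- a2) (- b1) (- b2) w); exact: su2_rotK.
have [T1 [h1 [p0 p1 p2 p3 [p4 p5]]]] := rot _ hE.
have h2 : su3_coframe (cycle_coord \o (T1 \o E)) F Psip Psim g.
  apply: su3_coframe_comp h1; first exact: cycle_coord_preserving.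
  move=> w; exists (cycle_coord (cycle_coord w)).
  by apply: row6P; rewrite /cycle_coord !mxE.
have [T2 [h3 [q0 q1 q2 q3 [q4 q5]]]] := rot _ h2.
exists (T2 \o (cycle_coord \o (T1 \o E))), (T2 (cycle_coord (T1 (E u))) 0 0).
split=> //; apply: row6P; rewrite /= ?q1 ?q2 ?q3 ?q4 ?q5 !mxE /= ?mulr1 ?mulr0
  ?p2 ?p3 //.
Qed.

End SU3Algebra.

Lemma mxrows1 (K : nmodType) (n : nat) (u : 'rV[K]_n) : mxrows 1 [:: u] = u.
Proof. by apply/rowP => j; rewrite !mxE. Qed.

Lemma lwedge11 (R : realType) (K : numFieldType) (n : nat)
    (a b : lfield R K n 1) x (u v : 'rV[R]_n) :
  lwedge a b x (mxrows 2 [:: u; v]) = a x u * b x v - a x v * b x u.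
Proof.
rewrite lwedge1l; last exact: antisym_rows1.
rewrite !big_ord_recl big_ord0 !row_mxrows !row'_mxrows /= !mxrows1.
by rewrite expr0 mul1r expr1 mulN1r addr0.
Qed.

Lemma linear_form_rowP (R : realType) (f : 'rV[R]_6 -> R) :
  multilinear_rows (f : 'M[R]_(1, 6) -> R) ->
  forall u, f u = \sum_j u 0 j * f (delta_mx 0 j).
Proof.
move=> hf u; have := multilinear_delta hf ord0 u 0.
have e w : mxset (ord0 : 'I_1) w (0 : 'M[R]_(1, 6)) = w.
  by apply/row_matrixP => i; rewrite row_mxset !ord1 eqxx row_id.
by rewrite e => ->; apply: eq_bigr => j _; rewrite e.
Qed.

(** At a point the coframe is right multiplication by the matrix [P] of its values on the standard
    basis, and linear independence makes [P] invertible. *)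
Lemma adapted_coframe_su3 (R : realType) (A : set 'rV[R]_6)
    (f : 'I_6 -> lfield R R 6 1) (F : lfield R R 6 2)
    (Psip Psim : lfield R R 6 3) (g : 'M[R]_(2, 6) -> R) x :
  adapted_coframe A f F Psip Psim -> A x ->
  (forall V, g V = \sum_a f a x (row 0 V) * f a x (row 1 V)) ->
  exists P, P \in unitmx /\
    su3_coframe (mulmxr P) (F x) (Psip x) (Psim x) g.
Proof.
move=> [_ flin find hF hPsi] Ax hg.
pose P : 'M[R]_6 := \matrix_(b, a) f a x (delta_mx 0 b).
have fP a u : f a x u = (u *m P) 0 a.
  rewrite (linear_form_rowP (flin a x Ax)) mxE.
  by apply: eq_bigr => j _; rewrite mxE.
have uP : P \in unitmx.
  rewrite -unitmx_tr -row_free_unit -kermx_eq0; apply/rowV0P => c /sub_kermxP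
    hc.
  apply/rowP => a; rewrite mxE; apply: (find x Ax (fun a => c 0 a)) => v.
  transitivity ((v *m (c *m P^T)^T) 0 0); last by rewrite hc trmx0 mulmx0 mxE.
  rewrite trmx_mul trmxK mulmxA mxE; apply: eq_bigr => b _.
  by rewrite fP [c^T _ _]mxE mulrC.
exists P; split=> //.
have hPsi' u v w : Psip x (mxrows 3 [:: u; v; w]) = su3_re (u *m P) (v *m P) (w
  *m P)
    /\ Psim x (mxrows 3 [:: u; v; w]) = su3_im (u *m P) (v *m P) (w *m P).
  have := hPsi x Ax (mxrows 3 [:: u; v; w]).
  rewrite lwedge21 => [|? ?]; last exact: lwedge_antisym.
  rewrite !row'_mxrows !row_mxrows /= !lwedge11 /complex_form !fP.
  (* Real and imaginary parts of the complex volume form give Psi_+ and Psi_-. *)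
  simpc => -[-> ->].
  by rewrite /su3_re /su3_im /minor3 /minor2; split; ring.
split=> /=.
- by move=> w; exists (w *m invmx P); rewrite mulmxKV.
- by move=> u v; rewrite hF // !lwedge11 !fP /su3_F /minor2 /=; ring.
- by move=> u v w; have [] := hPsi' u v w.
- by move=> u v w; have [] := hPsi' u v w.
- move=> u v; rewrite hg !row_mxrows /= /su3_dot.
  rewrite !big_ord_recl big_ord0 addr0 !fP !addrA.
  have e1 : lift ord0 ord0 = 1 :> 'I_6 by exact: val_inj.
  have e2 : lift ord0 (lift ord0 ord0) = 2 :> 'I_6 by exact: val_inj.
  have e3 : lift ord0 (lift ord0 (lift ord0 ord0)) = 3 :> 'I_6 by exact:
    val_inj.
  have e4 : lift ord0 (lift ord0 (lift ord0 (lift ord0 ord0))) = 4 :> 'I_6.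
    exact: val_inj.
  have e5 : lift ord0 (lift ord0 (lift ord0 (lift ord0 (lift ord0 ord0)))) = 5
    :> 'I_6 by exact: val_inj.
  by rewrite e1 e2 e3 e4 e5.
Qed.

Lemma row_row_perm (R : Type) (m n : nat) (s : 'S_m) (A : 'M[R]_(m, n)) i :
  row i (row_perm s A) = row (s i) A.
Proof. by rewrite row_permEsub row_rowsub. Qed.

Lemma mxrows2P (K : nmodType) (n : nat) (V : 'M[K]_(2, n)) :
  exists u v, V = mxrows 2 [:: u; v].
Proof. by rewrite (mxrowsE V) !enum_ordSl enum_ord0 /=; eexists _, _. Qed.

Lemma mxrows3P (K : nmodType) (n : nat) (V : 'M[K]_(3, n)) :
  exists u v w, V = mxrows 3 [:: u; v; w].
Proof. by rewrite (mxrowsE V) !enum_ordSl enum_ord0 /=; eexists _, _, _. Qed.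

Lemma mxrows4P (K : nmodType) (n : nat) (V : 'M[K]_(4, n)) :
  exists u v w z, V = mxrows 4 [:: u; v; w; z].
Proof. by rewrite (mxrowsE V) !enum_ordSl enum_ord0 /=; eexists _, _, _, _. Qed.

Lemma liprod_antisym (R : realType) (n k : nat) (X : 'rV[R]_n -> 'rV[R]_n)
    (w : lfield R R n k.+1) x :
  antisym_rows (w x) -> antisym_rows (liprod X w x).
Proof.
move=> hw s V; rewrite /liprod.
have -> : (-1) ^+ s = (-1) ^+ lift_perm ord0 ord0 s :> R.
  by rewrite odd_lift_perm.
rewrite -hw; congr (w x _); apply: col_mx_row_matrixP => [|i].
  by rewrite row_row_perm lift_perm_id !row0_col_mx.
by rewrite row_row_perm lift_perm_lift !rowS_col_mx row_row_perm.
Qed.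

Lemma lwedge12 (R : realType) (n : nat) (a : lfield R R n 1) (b : lfield R R n
  2)
    x (u v w : 'rV[R]_n) : antisym_rows (b x) ->
  lwedge a b x (mxrows 3 [:: u; v; w]) =
    a x u * b x (mxrows 2 [:: v; w]) - a x v * b x (mxrows 2 [:: u; w])
    + a x w * b x (mxrows 2 [:: u; v]).
Proof.
move=> hb; rewrite lwedge1l // !big_ord_recl big_ord0 !row_mxrows !row'_mxrows
  /=.
by rewrite expr0 /bump /= !addn0 expr1 expr2 mulN1r mul1r mulrNN !mul1r addr0
  addrA.
Qed.

(** * Values of the contracted forms in a coframe along X *)

Section SU3Values.
Context (R : realType) (E : 'rV[R]_6 -> 'rV[R]_6) (c : R).
Context (F : lfield R R 6 2) (Psip Psim : lfield R R 6 3) (g : lfield R R 6 2).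
Context (X : 'rV[R]_6 -> 'rV[R]_6) (alpha : lfield R R 6 1) (x : 'rV[R]_6).
Hypotheses (hE : su3_coframe E (F x) (Psip x) (Psim x) (g x))
  (EX : E (X x) = c *: delta_mx 0 0) (c0 : c != 0)
  (hF : antisym_rows (F x)) (hp : antisym_rows (Psip x))
  (hm : antisym_rows (Psim x))
  (halpha : forall v, alpha x v = (c ^+ 2)^-1 * g x (mxrows 2 [:: v; X x])).

Let X0 : E (X x) 0 0 = c. Proof. by rewrite EX !mxE /= mulr1. Qed.
Let X1 : E (X x) 0 1 = 0. Proof. by rewrite EX !mxE /= mulr0. Qed.
Let X2 : E (X x) 0 2 = 0. Proof. by rewrite EX !mxE /= mulr0. Qed.
Let X3 : E (X x) 0 3 = 0. Proof. by rewrite EX !mxE /= mulr0. Qed.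
Let X4 : E (X x) 0 4 = 0. Proof. by rewrite EX !mxE /= mulr0. Qed.
Let X5 : E (X x) 0 5 = 0. Proof. by rewrite EX !mxE /= mulr0. Qed.
Let XE := (X0, X1, X2, X3, X4, X5).

Lemma alpha_coframe u : alpha x u = E u 0 0 / c.
Proof.
have [_ _ _ _ hg] := hE.
by rewrite halpha hg /su3_dot !XE; field.
Qed.

Lemma iprod_F_coframe u : liprod X F x u = c * E u 0 1.
Proof.
have [_ hF' _ _ _] := hE.
by rewrite /liprod -{1}(mxrows1 u) col_mx_mxrows hF' /su3_F /minor2 !XE; ring.
Qed.

Lemma iprod_Psip_coframe u v : liprod X Psip x (mxrows 2 [:: u; v]) =
  c * (minor2 2 4 (E u) (E v) - minor2 3 5 (E u) (E v)).
Proof.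
have [_ _ hp' _ _] := hE.
by rewrite /liprod col_mx_mxrows hp' /su3_re /minor3 /minor2 !XE; ring.
Qed.

Lemma iprod_Psim_coframe u v : liprod X Psim x (mxrows 2 [:: u; v]) =
  c * (minor2 2 5 (E u) (E v) + minor2 3 4 (E u) (E v)).
Proof.
have [_ _ _ hm' _] := hE.
by rewrite /liprod col_mx_mxrows hm' /su3_im /minor3 /minor2 !XE; ring.
Qed.

Lemma iprod_F_alpha_coframe u v :
  liprod X (lwedge F alpha) x (mxrows 2 [:: u; v]) =
  minor2 2 3 (E u) (E v) + minor2 4 5 (E u) (E v).
Proof.
have [_ hF' _ _ _] := hE.
rewrite /liprod col_mx_mxrows (lwedge21 _ hF) !row'_mxrows !row_mxrows /=.
by rewrite !alpha_coframe !hF' /su3_F /minor2 !XE; field.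
Qed.

(** Both sides are - c^2 f^2 /\ (f^34 + f^56), since i_X (F /\ F) = 2 c f^2 /\ (f^34 + f^56). *)
Lemma eta_omega1 V :
  lwedge (- liprod X F) (fun y W => c * liprod X (lwedge F alpha) y W) x V =
  - (c / 2) * liprod X (lwedge F F) x V.
Proof.
have [_ hF' _ _ _] := hE.
have [u [v [w ->]]] := mxrows3P V.
have h : antisym_rows ((fun y W => c * liprod X (lwedge F alpha) y W) x).
  move=> s W /=; rewrite [RHS]mulrCA; congr (_ * _).
  exact: (@liprod_antisym R 6 2 X (lwedge F alpha) x (lwedge_antisym F alpha
    x)).
rewrite (lwedge12 _ _ _ _ h) !iprod_F_alpha_coframe.
rewrite [liprod X (lwedge F F) x _]/liprod col_mx_mxrows.
rewrite (lwedge22 hF hF) /= !hF'.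
have e u' : (- liprod X F) x u' = - (c * E u' 0 1) by rewrite -iprod_F_coframe.
by rewrite !e /su3_F /minor2 !XE; field.
Qed.

(** alpha /\ i_X Psi_+ = f^135 - f^146 is the part of Psi_+ that contains f^1; what remains is -
    f^236 - f^245. *)
Lemma eta_omega2 V :
  lwedge (- liprod X F) (liprod X Psim) x V =
  c ^+ 2 * (Psip x V - lwedge alpha (liprod X Psip) x V).
Proof.
have [_ _ hp' _ _] := hE.
have [u [v [w ->]]] := mxrows3P V.
have e u' : (- liprod X F) x u' = - (c * E u' 0 1) by rewrite -iprod_F_coframe.
rewrite !lwedge12; try exact: liprod_antisym.
rewrite !e !iprod_Psim_coframe !iprod_Psip_coframe !alpha_coframe hp'.
by rewrite /su3_re /minor3 /minor2; field.
Qed.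

End SU3Values.

(** * The SU(2) conditions at a point of the orbit space *)

Section SU2Pointwise.
Context (R : realType) (E : 'rV[R]_6 -> 'rV[R]_6) (J : 'M[R]_(6, 5)) (c : R).
Context (eta : lfield R R 5 1) (w1 w2 w3 : lfield R R 5 2) (y : 'rV[R]_5).
Hypotheses (surjE : forall w, exists u, E u = w)
  (surjJ : forall v : 'rV_5, exists u, u *m J = v) (c0 : 0 < c)
  (heta : forall u, eta y (u *m J) = - (c * E u 0 1))
  (h1 : forall u v, w1 y (mxrows 2 [:: u *m J; v *m J]) =
     c * (minor2 2 3 (E u) (E v) + minor2 4 5 (E u) (E v)))
  (h2 : forall u v, w2 y (mxrows 2 [:: u *m J; v *m J]) =
     c * (minor2 2 5 (E u) (E v) + minor2 3 4 (E u) (E v)))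
  (h3 : forall u v, w3 y (mxrows 2 [:: u *m J; v *m J]) =
     - (c * (minor2 2 4 (E u) (E v) - minor2 3 5 (E u) (E v))))
  (a1 : antisym_rows (w1 y)) (a2 : antisym_rows (w2 y))
  (a3 : antisym_rows (w3 y)).

Lemma su2_wedge_relations (a b : 'I_3) V :
  lwedge (tnth [tuple w1; w2; w3] a) (tnth [tuple w1; w2; w3] b) y V =
  (a == b)%:R * lwedge w1 w1 y V.
Proof.
have [u' [v' [w' [z' ->]]]] := mxrows4P V.
have [u <-] := surjJ u'; have [v <-] := surjJ v'.
have [w <-] := surjJ w'; have [z <-] := surjJ z'.
have e11 := lwedge22 a1 a1 (u *m J) (v *m J) (w *m J) (z *m J).
rewrite e11 /=.
case: a => -[|[|[|//]]] ha; case: b => -[|[|[|//]]] hb;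
  rewrite !(tnth_nth w1) /= ?e11 ?mul1r ?mul0r //; rewrite lwedge22 //= !(h1,
    h2, h3) /minor2; ring.
Qed.

(** Testing the hypothesis on preimages of the last four basis vectors expresses the coordinates 2
    to 5 of [E Z'] by those of [E Y'], and omega_2 becomes c times a sum of four squares. *)
Lemma su2_positive (Y Z : 'rV[R]_5) :
  (forall v : 'rV[R]_5, w3 y (col_mx Y v) = w1 y (col_mx Z v)) ->
  0 <= w2 y (col_mx Y Z).
Proof.
have [Y' <-] := surjJ Y; have [Z' <-] := surjJ Z => h.
have col2 (u v : 'rV[R]_5) : col_mx u v = mxrows (1 + 1) [:: u; v].
  by rewrite -{1}(mxrows1 v) col_mx_mxrows.
have {}h v : w3 y (mxrows 2 [:: Y' *m J; v *m J]) = w1 y (mxrows 2 [:: Z' *m J;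
  v *m J]).
  by have := h (v *m J); rewrite !col2.
have hb (b : 'I_6) : exists v, E v = delta_mx 0 b by exact: surjE.
have [v2 e2] := hb 2; have [v3 e3] := hb 3; have [v4 e4] := hb 4; have [v5 e5]
  := hb 5.
have k2 := h v2; have k3 := h v3; have k4 := h v4; have k5 := h v5.
rewrite h3 h1 e2 /minor2 !mxE /= !(mulr0, mulr1, subr0, sub0r, addr0, add0r,
  mul0r, oppr0) in k2.
rewrite h3 h1 e3 /minor2 !mxE /= !(mulr0, mulr1, subr0, sub0r, addr0, add0r,
  mul0r, oppr0) in k3.
rewrite h3 h1 e4 /minor2 !mxE /= !(mulr0, mulr1, subr0, sub0r, addr0, add0r,
  mul0r, oppr0) in k4.
rewrite h3 h1 e5 /minor2 !mxE /= !(mulr0, mulr1, subr0, sub0r, addr0, add0r,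
  mul0r, oppr0) in k5.
have cn : c != 0 by rewrite gt_eqF.
have i2 : E Y' 0 4 = - E Z' 0 3 by apply: (mulfI cn); lra.
have i3 : - E Y' 0 5 = E Z' 0 2 by apply: (mulfI cn); lra.
have i4 : - E Y' 0 2 = - E Z' 0 5 by apply: (mulfI cn); lra.
have i5 : E Y' 0 3 = E Z' 0 4 by apply: (mulfI cn); lra.
rewrite col2 h2 mulr_ge0 ?(ltW c0) // /minor2 -i3 -i5.
have -> : E Z' 0 5 = E Y' 0 2 by lra.
have -> : E Z' 0 3 = - E Y' 0 4 by lra.
have -> : E Y' 0 2 * E Y' 0 2 - E Y' 0 5 * - E Y' 0 5
    + (E Y' 0 3 * E Y' 0 3 - E Y' 0 4 * - E Y' 0 4) =
  E Y' 0 2 ^+ 2 + E Y' 0 5 ^+ 2 + E Y' 0 3 ^+ 2 + E Y' 0 4 ^+ 2 by ring.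
by rewrite !addr_ge0 ?sqr_ge0.
Qed.

Lemma su2_eta_neq0 : exists V, eta y V != 0.
Proof.
have [u eu] := surjE (delta_mx 0 1); exists (u *m J).
by rewrite heta eu mxE /= mulr1 oppr_eq0 gt_eqF.
Qed.

(** Upstairs omega_1 /\ omega_1 = 2 c^2 f^3456 and eta = - c f^2, so preimages of the basis vectors
    dual to f^3, ..., f^6, followed by f^2, detect both forms. *)
Lemma su2_volume_neq0 : (exists V, lwedge w1 w1 y V != 0) /\
  exists V, lwedge (lwedge w1 w1) eta y V != 0.
Proof.
have hb (b : 'I_6) : exists v, E v = delta_mx 0 b by exact: surjE.
have [v1 e1] := hb 1; have [v2 e2] := hb 2; have [v3 e3] := hb 3.
have [v4 e4] := hb 4; have [v5 e5] := hb 5.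
have hv : lwedge w1 w1 y
    (mxrows 4 [:: v2 *m J; v3 *m J; v4 *m J; v5 *m J]) = 2 * c ^+ 2.
  rewrite lwedge22 //= !h1 e2 e3 e4 e5 /minor2 !mxE /=; ring.
have n0 : 2 * c ^+ 2 != 0 by rewrite mulf_neq0 // expf_neq0 // gt_eqF.
split; first by exists (mxrows 4 [:: v2 *m J; v3 *m J; v4 *m J; v5 *m J]);
  rewrite hv.
pose V := mxrows 5 [:: v2 *m J; v3 *m J; v4 *m J; v5 *m J; v1 *m J].
have hz (i : 'I_4) : eta y (row (lift ord_max i) V) = 0.
  case: i => -[|[|[|[|//]]]] hi; rewrite row_mxrows /= heta ?e2 ?e3 ?e4 ?e5 mxE
    /=;
    by rewrite mulr0 oppr0.
exists V; rewrite (lwedge41 (@lwedge_antisym _ _ _ 2 2 w1 w1 y) hz).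
rewrite row_mxrows row'_mxrows /= hv heta e1 mxE /= mulr1.
by rewrite mulf_neq0 // oppr_eq0 gt_eqF.
Qed.

End SU2Pointwise.

(** * Leibniz rules *)

Lemma antisym_rows_swap (R : nzRingType) (K : pzRingType) (n : nat)
    (f : 'M[R]_(2, n) -> K) :
  (forall u v, f (mxrows 2 [:: u; v]) = - f (mxrows 2 [:: v; u])) ->
  antisym_rows f.
Proof.
move=> hf s V; have [u [v ->]] := mxrows2P V.
have ord2 (i : 'I_2) : i = 0 \/ i = 1.
  by case: i => -[|[|//]] hi; [left|right]; exact: val_inj.
have hs0 := ord2 (s 0); have hs1 := ord2 (s 1).
have s01 : s 0 != s 1 by rewrite (inj_eq perm_inj).
have [[e0 e1]|[e0 e1]] : (s 0 = 0 /\ s 1 = 1) \/ (s 0 = 1 /\ s 1 = 0).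
- by case: hs0 s01 => ->; case: hs1 => ->; rewrite ?eqxx //; [left|right].
- have -> : s = 1%g by apply/permP => i; rewrite perm1; case: (ord2 i) => ->.
  by rewrite row_perm1 odd_perm1 mul1r.
have -> : s = tperm 0 1.
  by apply/permP => i; case: (ord2 i) => ->; rewrite ?tpermL ?tpermR.
rewrite odd_tperm /= expr1 mulN1r -hf; congr (f _); apply/row_matrixP => i.
by rewrite row_row_perm !row_mxrows; case: (ord2 i) => ->; rewrite ?tpermL
  ?tpermR.
Qed.

Section LocalForms.
Context (R : realType) (n : nat).

Lemma row_perm_mxset k (s : 'S_k) r u (V : 'M[R]_(k, n)) :
  row_perm s (mxset (s r) u V) = mxset r u (row_perm s V).
Proof.
apply/row_matrixP => i; rewrite row_row_perm !row_mxset (inj_eq perm_inj).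
by rewrite row_row_perm.
Qed.

Lemma usubmx_mxset_lshift k l r u (V : 'M[R]_(k + l, n)) :
  usubmx (mxset (lshift l r) u V) = mxset r u (usubmx V).
Proof.
by apply/row_matrixP => i; rewrite row_usubmx !row_mxset eq_lshift row_usubmx.
Qed.

Lemma usubmx_mxset_rshift k l r u (V : 'M[R]_(k + l, n)) :
  usubmx (mxset (rshift k r) u V) = usubmx V.
Proof.
by apply/row_matrixP => i; rewrite !row_usubmx row_mxset eq_lrshift.
Qed.

Lemma dsubmx_mxset_lshift k l r u (V : 'M[R]_(k + l, n)) :
  dsubmx (mxset (lshift l r) u V) = dsubmx V.
Proof.
by apply/row_matrixP => i; rewrite !row_dsubmx row_mxset eq_rlshift.
Qed.

Lemma dsubmx_mxset_rshift k l r u (V : 'M[R]_(k + l, n)) :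
  dsubmx (mxset (rshift k r) u V) = mxset r u (dsubmx V).
Proof.
by apply/row_matrixP => i; rewrite row_dsubmx !row_mxset eq_rshift row_dsubmx.
Qed.

Lemma is_derive_lwedge k l (a : lfield R R n k) (b : lfield R R n l) x v V
    (da : 'M[R]_(k, n) -> R) (db : 'M[R]_(l, n) -> R) :
  (forall A, is_derive x v (a^~ A) (da A)) ->
  (forall B, is_derive x v (b^~ B) (db B)) ->
  is_derive x v (fun y => lwedge a b y V)
    (lwedge (fun=> da) b x V + lwedge a (fun=> db) x V).
Proof.
move=> ha hb; rewrite /lwedge -mulrDr -big_split /=.
have hs (s : 'S_(k + l)) := is_derive_fmul (is_derive_cst ((-1) ^+ s : R) x v)
  (is_derive_fmul (ha (usubmx (row_perm s V))) (hb (dsubmx (row_perm s V)))).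
have := is_derive_fmul (is_derive_cst ((k`! * l`!)%:R^-1 : R) x v)
  (is_derive_fsum (index_enum _) hs).
rewrite mul0r add0r => h; apply: (is_derive_eq h) => /=; congr (_ * _).
by apply: eq_bigr => s _; rewrite mul0r add0r mulrDr.
Qed.

Lemma llie_lwedge k l (X : 'rV[R]_n -> 'rV[R]_n) (a : lfield R R n k)
    (b : lfield R R n l) x V :
  (forall A, derivable (a^~ A) x (X x)) ->
  (forall B, derivable (b^~ B) x (X x)) ->
  llie X (lwedge a b) x V = lwedge (llie X a) b x V + lwedge a (llie X b) x V.
Proof.
move=> ha hb.
have [_ e] := is_derive_lwedge V (fun A => derivableP (ha A)) (fun B =>
  derivableP (hb B)).
pose Xa W := \sum_(i < k) a x (mxset i ('D_(row i W) X x) W).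
pose Xb W := \sum_(i < l) b x (mxset i ('D_(row i W) X x) W).
have e2 : \sum_(i < k + l) lwedge a b x (mxset i ('D_(row i V) X x) V) =
    lwedge (fun=> Xa) b x V + lwedge a (fun=> Xb) x V.
  rewrite /lwedge -big_distrr -mulrDr exchange_big -big_split /=; congr (_ * _).
  apply: eq_bigr => s _; rewrite -big_distrr -!mulrDr /=; congr (_ * _).
  (* Reindexed by [s], the sum over the modified row splits into the rows fed to [a] and those fed
     to [b]. *)
  rewrite (reindex_inj (@perm_inj _ s)) big_split_ord /= /Xa /Xb.
  congr (_ + _); rewrite ?big_distrl ?big_distrr; apply: eq_bigr => i _ /=.
    rewrite row_perm_mxset usubmx_mxset_lshift dsubmx_mxset_lshift.
    by rewrite row_usubmx row_row_perm.
  rewrite row_perm_mxset usubmx_mxset_rshift dsubmx_mxset_rshift.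
  by rewrite row_dsubmx row_row_perm.
transitivity (lwedge (fun=> (fun A => 'D_(X x) (a^~ A) x)) b x V +
    lwedge a (fun=> (fun B => 'D_(X x) (b^~ B) x)) x V +
    (lwedge (fun=> Xa) b x V + lwedge a (fun=> Xb) x V)).
  by rewrite /llie e -e2.
rewrite /lwedge -!mulrDr -!big_split /=; congr (_ * _); apply: eq_bigr => s _.
rewrite /llie -/(Xa _) -/(Xb _) -!mulrDr; congr (_ * _); ring.
Qed.

Lemma lext_scale k (c : R) (w : lfield R R n k) x V :
  (forall A v, derivable (w^~ A) x v) ->
  lext (fun y W => c * w y W) x V = c * lext w x V.
Proof.
move=> dw; rewrite /lext big_distrr; apply: eq_bigr => i _ /=.
rewrite mulrCA; congr (_ * _).
have := is_derive_fmul (is_derive_cst c x (row i V))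
  (derivableP (dw (row' i V) (row i V))).
by rewrite mul0r add0r => -[].
Qed.

Lemma lextB k (w t : lfield R R n k) x V :
  (forall A v, derivable (w^~ A) x v) -> (forall A v, derivable (t^~ A) x v) ->
  lext (fun y W => w y W - t y W) x V = lext w x V - lext t x V.
Proof.
move=> dw dt; rewrite /lext -sumrB; apply: eq_bigr => i _.
by rewrite -mulrBr -deriveB.
Qed.

Lemma lext1 (a : lfield R R n 1) x (u v : 'rV[R]_n) :
  lext a x (mxrows 2 [:: u; v]) = 'D_u (a^~ v) x - 'D_v (a^~ u) x.
Proof.
rewrite /lext !big_ord_recl big_ord0 !row_mxrows !row'_mxrows /= !mxrows1.
by rewrite expr0 mul1r expr1 mulN1r addr0.
Qed.

Lemma lext2 (b : lfield R R n 2) x (u v w : 'rV[R]_n) :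
  lext b x (mxrows 3 [:: u; v; w]) =
  'D_u (b^~ (mxrows 2 [:: v; w])) x - 'D_v (b^~ (mxrows 2 [:: u; w])) x
  + 'D_w (b^~ (mxrows 2 [:: u; v])) x.
Proof.
rewrite /lext !big_ord_recl big_ord0 !row_mxrows !row'_mxrows /=.
by rewrite expr0 /bump /= !addn0 expr1 expr2 mulN1r mul1r mulrNN !mul1r addr0
  addrA.
Qed.

Lemma lext3 (b : lfield R R n 3) x (u v w z : 'rV[R]_n) :
  lext b x (mxrows 4 [:: u; v; w; z]) =
  'D_u (b^~ (mxrows 3 [:: v; w; z])) x - 'D_v (b^~ (mxrows 3 [:: u; w; z])) x
  + 'D_w (b^~ (mxrows 3 [:: u; v; z])) x - 'D_z (b^~ (mxrows 3 [:: u; v; w])) x.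
Proof.
rewrite /lext !big_ord_recl big_ord0 !row_mxrows !row'_mxrows /=.
rewrite expr0 /bump /= !addn0 expr1 expr2 mulrNN exprS expr2 !mulrNN !mul1r
  !mulr1.
by rewrite !mulN1r addr0 !addrA.
Qed.

(** Meant for a = alpha and b = i_X Psi_+: since b is closed, the term - a /\ d b of the Leibniz
    rule drops out. *)
Lemma lext_lwedge12 (a : lfield R R n 1) (b : lfield R R n 2) x V :
  (\forall y \near x, antisym_rows (b y)) ->
  (forall A v, derivable (a^~ A) x v) -> (forall B v, derivable (b^~ B) x v) ->
  (forall W, lext b x W = 0) ->
  lext (lwedge a b) x V = lwedge (lext a) b x V.
Proof.
move=> hb da db db0; have [u [v [w [z ->]]]] := mxrows4P V.
have D p q r s : 'D_s ((lwedge a b)^~ (mxrows 3 [:: p; q; r])) x =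
  ('D_s (a^~ p) x * b x (mxrows 2 [:: q; r]) + a x p * 'D_s (b^~ (mxrows 2 [::
    q; r])) x)
  - ('D_s (a^~ q) x * b x (mxrows 2 [:: p; r]) + a x q * 'D_s (b^~ (mxrows 2 [::
    p; r])) x)
  + ('D_s (a^~ r) x * b x (mxrows 2 [:: p; q]) + a x r * 'D_s (b^~ (mxrows 2 [::
    p; q])) x).
  have h p' q' r' := is_derive_fmul (derivableP (da p' s))
    (derivableP (db (mxrows 2 [:: q'; r']) s)).
  have [_ <-] := is_deriveD (is_deriveB (h p q r) (h q p r)) (h r p q).
  apply: near_eq_derive; apply: filterS hb => y hy.
  by rewrite (lwedge12 _ _ _ _ hy).
have ha : antisym_rows (lext a x).
  apply: antisym_rows_swap => p q; rewrite !lext1; ring.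
(* Adding back - a /\ d b, which is zero, makes the claim an identity valid for arbitrary values and
   derivatives of [a] and [b]. *)
transitivity (lwedge (lext a) b x (mxrows 4 [:: u; v; w; z])
    - a x u * lext b x (mxrows 3 [:: v; w; z])
    + a x v * lext b x (mxrows 3 [:: u; w; z])
    - a x w * lext b x (mxrows 3 [:: u; v; z])
    + a x z * lext b x (mxrows 3 [:: u; v; w])); last first.
  by rewrite !db0 !mulr0 !subr0 !addr0.
rewrite (lext3 (lwedge a b)) !D lwedge22 //=; last exact: nbhs_singleton hb.
rewrite !lext1 !lext2.
(* The derivatives are abstracted so that [ring] meets only atoms. *)
have [Da hDa] : exists Da, forall p q, 'D_q (a^~ p) x = Da p q.
  by exists (fun p q => 'D_q (a^~ p) x).
have [Db hDb] : exists Db, forall B q, 'D_q (b^~ B) x = Db B q.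
  by exists (fun B q => 'D_q (b^~ B) x).
by rewrite !hDa !hDb; ring.
Qed.

End LocalForms.

(** * Descent along a submersion *)

Lemma lextN (R : realType) (n k : nat) (w : lfield R R n k) x V :
  (forall A v, derivable (w^~ A) x v) -> lext (- w) x V = - lext w x V.
Proof.
move=> dw; rewrite /lext -sumrN; apply: eq_bigr => i _.
by rewrite -mulrN -deriveN.
Qed.

Lemma derive_comm_rV (R : realType) (m n : nat) (phi : 'rV[R]_m -> 'rV[R]_n)
    (x u v : 'rV[R]_m) :
  (\forall y \near x, differentiable phi y) ->
  differentiable (fun y => 'D_u phi y) x ->
  differentiable (fun y => 'D_v phi y) x ->
  'D_u (fun y => 'D_v phi y) x = 'D_v (fun y => 'D_u phi y) x.
Proof.
move=> dphi du dv.
have coord (f : 'rV[R]_m -> 'rV[R]_n) y b : differentiable f y ->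
    differentiable (fun z => f z 0 b) y.
  move=> df; apply: (differentiable_comp (g := fun N : 'rV[R]_n => N 0 b)) =>
    //.
  exact: differentiable_coord.
have near_coord w b :
    \forall y \near x, 'D_w phi y 0 b = 'D_w (fun z => phi z 0 b) y.
  apply: filterS dphi => y dy; rewrite derive_mx ?mxE //.
  exact: diff_derivable.
have dcoord w b : differentiable (fun y => 'D_w phi y) x ->
    differentiable ('D_w (fun z => phi z 0 b)) x.
  move=> dw; apply: near_eq_differentiable (coord _ _ b dw).
  exact: near_coord.
have hu := @diff_derivable _ _ _ _ x v du.
have hv := @diff_derivable _ _ _ _ x u dv.
apply/rowP => b; rewrite (derive_mx hu) (derive_mx hv) [LHS]mxE [RHS]mxE.
rewrite (near_eq_derive _ (near_coord v b)) (near_eq_derive _ (near_coord u b)).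
apply: derive_comm; [|exact: dcoord|exact: dcoord].
by apply: filterS dphi => y; exact: coord.
Qed.

Section Descent.
Context (R : realType) (m n : nat) (M : manifold R m) (N : manifold R n).
Context (U : set M) (pr : M -> N).

Lemma wedge_descends k l (a : tfield M k) (b : tfield M l) (s : tfield N k)
    (t : tfield N l) :
  descends_to U pr a s -> descends_to U pr b t ->
  descends_to U pr (a \wedge b) (s \wedge t).
Proof.
move=> ha hb q i j Uq iq jq V; rewrite /wedge /lwedge; congr (_ * _).
apply: eq_bigr => sg _; congr (_ * (_ * _)).
  rewrite (ha q i j) //; congr (s j _ _); apply/row_matrixP => r.
  by rewrite row_mul !row_usubmx !row_row_perm row_mul.
rewrite (hb q i j) //; congr (t j _ _); apply/row_matrixP => r.
by rewrite row_mul !row_dsubmx !row_row_perm row_mul.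
Qed.

Hypotheses (oU : open U) (sub : submersion_on U pr) (surj : pr @` U = setT).

Lemma descends_point j y : cimg j y -> exists q i,
  [/\ U q, cdom i q, cdom j (pr q) & y = cmap j (pr q)].
Proof.
case=> nn jn <-; have : (pr @` U) nn by rewrite surj.
case=> q Uq e; have [i iq] := cdom_cover (m := M) q.
by exists q, i; rewrite e.
Qed.

Lemma descends_surj q i j : U q -> cdom i q -> cdom j (pr q) ->
  forall k (V : 'M[R]_(k, n)), exists W, W *m 'J (local_map pr i j) (cmap i q) =
    V.
Proof.
move=> Uq iq jq k V; have [_ /(_ q i j Uq iq jq) hJ] := sub.
by exists (V *m pinvmx ('J (local_map pr i j) (cmap i q))); rewrite mulmxKpV
  ?submx_full.
Qed.

Lemma descends_eq k (w w' : tfield M k) (t t' : tfield N k) :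
  descends_to U pr w t -> descends_to U pr w' t' -> eq_field w w' ->
  eq_field t t'.
Proof.
move=> hw hw' e j y /descends_point[q [i [Uq iq jq ->]]] V.
have [W <-] := descends_surj Uq iq jq V.
by rewrite -(hw q i j) // -(hw' q i j) // e //; exists q.
Qed.

(** In charts, [w] is the pullback of [t] by [phi] on the whole neighbourhood [D] of the point, so
    the relation can be differentiated. *)
Lemma ext_descends k (w : tfield M k.+1) (t : tfield N k.+1) :
  is_form t -> descends_to U pr w t -> descends_to U pr (ext w) (ext t).
Proof.
move=> ft hd q i j Uq iq jq V; rewrite /ext.
have [ts tm ta _] := ft.
have [[prc prs] _] := sub.
set phi := local_map pr i j; set x := cmap i q.
pose D := cmap i @` (cdom i `&` U `&` pr @^-1` cdom j).
have phix q' : cdom i q' -> phi (cmap i q') = cmap j (pr q').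
  by move=> iq'; rewrite /phi /local_map /= cmapK.
(* Continuity of [cinv i] and of [pr], with [U] and the chart domains open, makes [D] a
   neighbourhood of [x]. *)
have Dx : \forall y \near x, D y.
  have ix : cimg i x by exists q.
  have h1 : \forall y \near x, cimg i y.
    by apply: open_nbhs_nbhs; split=> //; exact: open_cimg.
  have h2 : \forall q' \near q, cdom i q' /\ U q' /\ cdom j (pr q').
    have n1 : nbhs q (cdom i) by apply: open_nbhs_nbhs; split=> //; exact:
      open_cdom.
    have n2 : nbhs q U by exact: open_nbhs_nbhs.
    have n3 : nbhs q (pr @^-1` cdom j).
      have pc := prc q Uq.
      by apply: (pc (cdom j)); apply: open_nbhs_nbhs; split=> //; exact:
        open_cdom.
    by apply: filterS3 n1 n2 n3 => q'.
  have h3 : \forall y \near x, cdom i (cinv i y) /\ U (cinv i y) /\ cdom j (pr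
    (cinv i y)).
    have cc := cinv_continuous ix.
    by apply: (cc [set q' | cdom i q' /\ U q' /\ cdom j (pr q')]); rewrite /x
      cmapK.
  apply: filterS2 h1 h3 => y [q' iq' <-]; rewrite cmapK // => -[_ [Uq' jq']].
  by exists q'.
have hsm : smooth_on phi D by exact: prs.
(* Order 2 makes [phi] and its directional derivatives differentiable, as the symmetry of second
   derivatives requires. *)
have [dphi ddphi] := hsm 2.
have Dx0 : D x by exact: nbhs_singleton Dx.
have dD v : differentiable (fun y => 'D_v phi y) x.
  by have [h _] := ddphi v; exact: h.
have dnear : \forall y \near x, differentiable phi y.
  by apply: filterS Dx => y Dy; exact: dphi.
have e : lext (w i) x = lext (lpullback phi (t j)) x.
  apply: lext_near => A; apply: filterS Dx => y [q' [[iq' Uq'] jq'] <-].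
  by rewrite /lpullback phix // (hd q' i j).
have jx : cimg j (phi x) by rewrite phix //; exists (pr q).
have h2 u v : derivable (fun y => 'D_u phi y) x v by exact: diff_derivable.
have h3 u v := derive_comm_rV dnear (dD u) (dD v).
have h4 : \forall y \near phi x, multilinear_rows (t j y).
  have : \forall y \near phi x, cimg j y.
    by apply: open_nbhs_nbhs; split=> //; exact: open_cimg.
  by apply: filterS => y; exact: tm.
have h6 A : differentiable ((t j)^~ A) (phi x) by have [h _] := ts j A 1; exact:
  h.
rewrite e (lext_pullback dnear h2 h3 h4 (is_form_antisym ft jx) h6).
by rewrite /lpullback phix.
Qed.

End Descent.

(** * Half-flat SU(3)-structures with an invariant vector field *)

Section HalfFlat.
Context (R : realType) (M : manifold R 6) (F : tfield M 2)
  (Psip Psim : tfield M 3) (g : tfield M 2) (X : vfield M) (c : R).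
Hypotheses (hflat : half_flat F Psip Psim)
  (hg : associated_metric F Psip Psim g) (hX : is_vector_field X)
  (c_gt0 : 0 < c)
  (hc : forall i x, cimg i x -> field_length g X i x = c).

Let fF : is_form F. Proof. by case: hflat => -[]. Qed.
Let fp : is_form Psip. Proof. by case: hflat => -[]. Qed.
Let fm : is_form Psim. Proof. by case: hflat => -[]. Qed.
Let c_neq0 : c != 0. Proof. by rewrite gt_eqF. Qed.

Lemma col_mx_mxrows2 (u v : 'rV[R]_6) : col_mx u v = mxrows 2 [:: u; v].
Proof. by rewrite -{1}(mxrows1 v) col_mx_mxrows. Qed.

Lemma form_derivable k (w : tfield M k) i x V v : is_form w -> cimg i x ->
  derivable ((w i)^~ V) x v.
Proof.
by move=> [ws _ _ _] ix; have [h _] := ws i V 1; apply: diff_derivable; exact: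
  h.
Qed.

Lemma cimg_near i x (P : 'rV[R]_6 -> Prop) : @cimg _ _ M i x ->
  (forall y, cimg i y -> P y) -> \forall y \near x, P y.
Proof.
move=> ix h; have : \forall y \near x, cimg i y.
  by apply: open_nbhs_nbhs; split=> //; exact: open_cimg.
by apply: filterS.
Qed.

Lemma form_multilinear_near k (w : tfield M k) i x : is_form w -> cimg i x ->
  \forall y \near x, multilinear_rows (w i y).
Proof. by move=> [_ wm _ _] ix; apply: cimg_near ix _ => y; exact: wm. Qed.

Lemma field_derivable i x v : cimg i x -> derivable (X i) x v.
Proof.
move=> ix; have [hs _] := hX; have [h _] := hs i 1.
by apply: diff_derivable; exact: h.
Qed.

Lemma field_coord_derive i x v b : cimg i x ->
  is_derive x v (fun y => X i y 0 b) (('D_v (X i) x) 0 b).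
Proof.
move=> ix; have d := @field_derivable i x v ix.
apply: DeriveDef; first exact: (derivable_mxP _ x v).1.
by rewrite derive_mx // mxE.
Qed.

Lemma metric_coframe i x : cimg i x -> exists P, P \in unitmx /\
  su3_coframe (mulmxr P) (F i x) (Psip i x) (Psim i x) (g i x).
Proof.
move=> ix; have [[_ _ _ hf] _ _] := hflat.
have [A [f [oA Ax AC ad]]] := hf i x ix.
apply: (adapted_coframe_su3 ad Ax) => V.
exact: (hg oA AC ad).
Qed.

Lemma coframe_along i x : cimg i x -> exists E,
  su3_coframe E (F i x) (Psip i x) (Psim i x) (g i x) /\
  E (X i x) = c *: delta_mx 0 0.
Proof.
move=> ix; have [P [_ hP]] := metric_coframe ix.
have [E [r [hE r0 EX]]] := su3_coframe_along (X i x) hP.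
exists E; split=> //; rewrite EX; congr (_ *: _).
(* The nonnegative factor [r] is the length of X, read off from the metric in the new coframe. *)
have [_ _ _ _ gE] := hE.
rewrite -(hc ix) /field_length col_mx_mxrows2 gE EX /su3_dot !mxE /=.
by rewrite !(mulr0, mulr1, addr0) -expr2 sqrtr_sqr ger0_norm.
Qed.

Lemma dual_formE i x v : cimg i x ->
  dual_form g X i x v = (c ^+ 2)^-1 * g i x (mxrows 2 [:: v; X i x]).
Proof. by move=> ix; rewrite /dual_form hc // col_mx_mxrows2. Qed.

(** Near [x], alpha(V) is c^-2 times the sum of the products f^a(V) f^a(X) for a smooth adapted
    coframe, with a constant factor because the length is constant. *)
Lemma dual_form_derivable i x V v : cimg i x ->
  derivable ((dual_form g X i)^~ V) x v.
Proof.
move=> ix; have [[_ _ _ hf] _ _] := hflat.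
have [A [f [oA Ax AC ad]]] := hf i x ix.
have [fs fl _ _ _] := ad.
have nA : \forall y \near x, A y by exact: open_nbhs_nbhs.
have df a B : is_derive x v ((f a)^~ B) ('D_v ((f a)^~ B) x).
  apply: derivableP; apply: diff_derivable; have [h _] := fs a B 1; exact: h.
have fX a : is_derive x v (fun y => f a y (X i y)) ('D_v ((f a)^~ (X i x)) x +
    \sum_b f a x (mxset b (row b ('D_v (X i) x)) (X i x))).
  have hlin : \forall y \near x, multilinear_rows (f a y).
    by apply: filterS nA => y; exact: fl.
  have dX r b : is_derive x v (fun y => X i y r b) (('D_v (X i) x) r b).
    by rewrite ord1; exact: field_coord_derive.
  exact: (@is_derive_multilinear R _ 6 1 (f a) (X i)
    (fun B => 'D_v ((f a)^~ B) x) ('D_v (X i) x) x v hlin (df a) dX).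
have h := is_derive_fmul (is_derive_cst ((c ^+ 2)^-1) x v)
  (is_derive_fsum (index_enum 'I_6) (fun a => is_derive_fmul (df a V) (fX a))).
have [d _] := h; apply: near_eq_derivable d.
apply: filterS nA => y Ay; rewrite dual_formE; last exact: AC.
rewrite (hg oA AC ad Ay) /=; congr (_ * _); apply: eq_bigr => a _.
by rewrite !row_mxrows.
Qed.

Lemma iprod_derivable k (w : tfield M k.+1) i x V v : is_form w -> cimg i x ->
  derivable ((iprod X w i)^~ V) x v.
Proof.
move=> fw ix.
by have [] := is_derive_liprod V (form_multilinear_near fw ix)
  (fun V => @form_derivable _ w i x V v fw ix) (fun b => @field_coord_derive i x
    v b ix).
Qed.

Lemma ext_iprod k (w : tfield M k.+1) i x V : is_form w ->
  cimg i x -> (forall A, lie X w i x A = 0) ->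
  ext (iprod X w) i x V = - iprod X (ext w) i x V.
Proof.
move=> fw ix hl.
have := llie_cartan (form_multilinear_near fw ix) (is_form_antisym fw ix)
  (fun V v => @form_derivable _ w i x V v fw ix) (fun v => @field_derivable i x
    v ix) V.
have := hl V; rewrite /lie => -> /esym/eqP.
by rewrite addr_eq0 => /eqP.
Qed.

Hypotheses (hLF : eq_field (lie X F) 0) (hLPsip : eq_field (lie X Psip) 0).

Lemma ext_iprod_Psip : eq_field (ext (iprod X Psip)) 0.
Proof.
move=> i x ix V; rewrite ext_iprod //; last by move=> A; rewrite hLPsip.
have [_ _ dp] := hflat.
by rewrite /iprod /liprod dp ?oppr0.
Qed.

Lemma ext_oppr_iprod_Psip : eq_field (ext (- iprod X Psip)) 0.
Proof.
move=> i x ix V; rewrite /ext.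
have -> : lext ((- iprod X Psip) i) x V = - lext (iprod X Psip i) x V.
  by apply: lextN => A v; exact: iprod_derivable.
by have := ext_iprod_Psip ix V; rewrite /ext => ->; rewrite oppr0.
Qed.

Lemma ext_eta_omega1 : eq_field (ext ((- iprod X F) \wedge
  fscale (field_length g X) (iprod X (F \wedge dual_form g X)))) 0.
Proof.
move=> i x ix V; rewrite /ext.
have fFF : is_form (F \wedge F : tfield M 4) by exact: (wedge_form fF fF).
have -> : lext (((- iprod X F) \wedge fscale (field_length g X)
      (iprod X (F \wedge dual_form g X))) i) x =
    lext (fun y W => - (c / 2) * iprod X (F \wedge F : tfield M 4) i y W) x.
  apply: lext_near => A; apply: cimg_near ix _ => y iy.
  have [E [hE EX]] := coframe_along iy.
  rewrite -(eta_omega1 hE EX c_neq0 (is_form_antisym fF iy) (fun v =>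
    @dual_formE i y v iy)).
  rewrite /wedge /lwedge; congr (_ * _); apply: eq_bigr => s _.
  by rewrite /fscale hc.
rewrite lext_scale => [|A v]; last exact: iprod_derivable.
have hl A : lie X (F \wedge F : tfield M 4) i x A = 0.
  transitivity (lwedge (llie (X i) (F i)) (F i) x A +
      lwedge (F i) (llie (X i) (F i)) x A).
    by apply: (@llie_lwedge R 6 2 2 (X i) (F i) (F i) x A) => B;
      exact: form_derivable.
  have lF B : llie (X i) (F i) x B = 0 by exact: (hLF ix B).
  rewrite /lwedge big1 => [|s _]; last by rewrite lF mul0r mulr0.
  by rewrite big1 => [|s _]; rewrite ?lF ?(mulr0, addr0).
have [_ dFF _] := hflat.
have e : iprod X (ext (F \wedge F : tfield M 4)) i x V = 0 by exact: (dFF i x ix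
  _).
have := ext_iprod V fFF ix hl; rewrite e oppr0 /ext => ->.
exact: mulr0.
Qed.

Lemma ext_eta_omega2 :
  eq_field (ext (dual_form g X) \wedge iprod X Psip) 0 ->
  eq_field (ext ((- iprod X F) \wedge iprod X Psim)) 0.
Proof.
move=> halpha i x ix V; rewrite /ext.
pose b := lwedge (dual_form g X i) (iprod X Psip i).
have -> : lext (((- iprod X F) \wedge iprod X Psim) i) x =
    lext (fun y W => c ^+ 2 * (Psip i y W - b y W)) x.
  apply: lext_near => A; apply: cimg_near ix _ => y iy.
  have [E [hE EX]] := coframe_along iy.
  exact: (eta_omega2 hE EX c_neq0 (is_form_antisym fp iy) (is_form_antisym fm
    iy)
    (fun v => @dual_formE i y v iy)).
have da A v : derivable ((dual_form g X i)^~ A) x v by exact: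
  dual_form_derivable.
have dp A v : derivable ((iprod X Psip i)^~ A) x v by exact: iprod_derivable.
have db A v : derivable (b^~ A) x v.
  by have [] := is_derive_lwedge A (fun A => derivableP (da A v)) (fun B =>
    derivableP (dp B v)).
have dP A v : derivable ((Psip i)^~ A) x v by exact: form_derivable.
rewrite lext_scale => [|A v]; last by apply: derivableB.
rewrite lextB // /b lext_lwedge12 //; last 2 first.
- apply: cimg_near ix _ => y iy; apply: liprod_antisym.
  exact: (is_form_antisym fp iy).
- by move=> W; have := ext_iprod_Psip ix W.
have [_ _ dPsip] := hflat.
have := dPsip i x ix V; rewrite /ext => ->.
by have := halpha i x ix V; rewrite /wedge /ext => ->; rewrite subr0 mulr0.
Qed.

(** d eta = i_X dF = 2 i_X Psi_+, and the sign in omega_3 = - i_X Psi_+ turns 2 into -2. *)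
Lemma ext_eta : eq_field (iprod X (ext F - 2 *: Psip)) 0 ->
  eq_field (ext (- iprod X F)) (- 2 *: (- iprod X Psip)).
Proof.
move=> h i x ix V; rewrite /ext.
have -> : lext ((- iprod X F) i) x V = - lext (iprod X F i) x V.
  by apply: lextN => A v; exact: iprod_derivable.
have := @ext_iprod _ F i x V fF ix; rewrite /ext => ->; last first.
  by move=> A; rewrite hLF.
have e : iprod X (ext F) i x V - 2 * iprod X Psip i x V = 0 by exact: (h i x ix
  V).
have -> : (- 2 *: (- iprod X Psip)) i x V = - 2 * - iprod X Psip i x V by [].
rewrite opprK; lra.
Qed.

End HalfFlat.

(** * The induced SU(2)-structure on the orbit space *)

Lemma length_pos (R : realType) (M : manifold R 6) (F : tfield M 2)
    (Psip Psim : tfield M 3) (g : tfield M 2) (X : vfield M) i x :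
  half_flat F Psip Psim -> associated_metric F Psip Psim g ->
  cimg i x -> X i x != 0 -> 0 < field_length g X i x.
Proof.
move=> hflat hg ix X0; have [P [uP [_ _ _ _ gE]]] := metric_coframe hflat hg ix.
rewrite lt_neqAle sqrtr_ge0 andbT eq_sym; apply: contra X0.
rewrite /field_length sqrtr_eq0 col_mx_mxrows2 gE /= /su3_dot -!expr2.
set z := X i x *m P => h.
have q0 := sqr_ge0 (z 0 0); have q1 := sqr_ge0 (z 0 1).
have q2 := sqr_ge0 (z 0 2); have q3 := sqr_ge0 (z 0 3).
have q4 := sqr_ge0 (z 0 4); have q5 := sqr_ge0 (z 0 5).
have z0 : z = 0.
  by apply: row6P; rewrite [RHS]mxE; apply/eqP; rewrite -sqrf_eq0; apply/eqP;
    lra.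
by rewrite -[X i x](mulmxK uP) -/z z0 mul0mx.
Qed.

Theorem theorem2p8 (R : realType) (M : manifold R 6)
    (F : tfield M 2) (Psip Psim : tfield M 3) (g : tfield M 2)
    (hflat : half_flat F Psip Psim)
    (hg : associated_metric F Psip Psim g)
    (X : vfield M) (hX : is_vector_field X)
    (hKilling : killing g X)
    (hlength : constant_length g X)
    (hLF : eq_field (lie X F) 0)
    (hLPsip : eq_field (lie X Psip) 0)
    (hLPsim : eq_field (lie X Psim) 0)
    (halpha : eq_field (ext (dual_form g X) \wedge iprod X Psip) 0)
    (p : M) (i0 : chart M) (hp : cdom i0 p) (hXp : X i0 (cmap i0 p) != 0)
    (N : manifold R 5) (U : set M) (pr : M -> N)
    (hU : U p) (hN : orbit_space X U pr)
    (eta : tfield N 1) (w1 w2 w3 : tfield N 2)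
    (form_eta : is_form eta)
    (form_w1 : is_form w1) (form_w2 : is_form w2) (form_w3 : is_form w3)
    (heta : descends_to U pr (- iprod X F) eta)
    (hw1 : descends_to U pr
             (fscale (field_length g X) (iprod X (F \wedge dual_form g X)))
             w1)
    (hw2 : descends_to U pr (iprod X Psim) w2)
    (hw3 : descends_to U pr (- iprod X Psip) w3) :
  hypo eta w1 w2 w3 /\
  (eq_field (iprod X (ext F - 2 *: Psip)) 0 -> hypo_contact eta w1 w2 w3).
Proof.
have [oU sub surj _] := hN.
have [c hc] := hlength.
have ip : cimg i0 (cmap i0 p) by exists p.
(* As the length is constant, X nonzero at [p] makes it positive everywhere. *)
have c0 : 0 < c.
  by rewrite -(hc i0 _ ip); exact: (length_pos hflat hg).
have [[fF fp fm _] _ _] := hflat.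
have su2 : su2_structure eta w1 w2 w3.
  (* Every vector at [y] is [u *m J] for some [u] at a chosen point of M above it, so the four forms
     can be read in coframe coordinates upstairs. *)
  have point j y : cimg j y -> exists (E : 'rV[R]_6 -> 'rV[R]_6) (J : 'M[R]_(6,
    5)),
      [/\ forall w, exists u, E u = w, forall v : 'rV_5, exists u, u *m J = v,
          forall u, eta j y (u *m J) = - (c * E u 0 1) &
          [/\ forall u v, w1 j y (mxrows 2 [:: u *m J; v *m J]) =
                c * (minor2 2 3 (E u) (E v) + minor2 4 5 (E u) (E v)),
              forall u v, w2 j y (mxrows 2 [:: u *m J; v *m J]) =
                c * (minor2 2 5 (E u) (E v) + minor2 3 4 (E u) (E v)) &
              forall u v, w3 j y (mxrows 2 [:: u *m J; v *m J]) =
                - (c * (minor2 2 4 (E u) (E v) - minor2 3 5 (E u) (E v)))]].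
    move=> /(descends_point surj)[q [i [Uq iq jq ->]]].
    have ix : cimg i (cmap i q) by exists q.
    have [E [hE EX]] := coframe_along hflat hg hc ix.
    exists E, ('J (local_map pr i j) (cmap i q)).
    have aF := is_form_antisym fF ix.
    have al v := @dual_formE R M g X c hc i (cmap i q) v ix.
    have mJ u v (J : 'M[R]_(6, 5)) :
        mxrows 2 [:: u *m J; v *m J] = mxrows 2 [:: u; v] *m J.
      by rewrite mxrows_mul.
    split; [by have [] := hE|exact: (descends_surj sub)| |split] => u.
    - by rewrite -(heta q i j) // -(iprod_F_coframe hE EX).
    - move=> v; rewrite mJ -(hw1 q i j) // -(iprod_F_alpha_coframe hE EX _ aF
      al) ?gt_eqF //.
      by rewrite /fscale hc.
    - by move=> v; rewrite mJ -(hw2 q i j) // -(iprod_Psim_coframe hE EX).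
    - by move=> v; rewrite mJ -(hw3 q i j) // -(iprod_Psip_coframe hE EX).
  split.
  - split=> // j y jy; have [E [J [sE sJ he _]]] := point j y jy.
    exact: (su2_eta_neq0 sE c0 he).
  - by case=> -[|[|[|//]]] h; rewrite (tnth_nth w1).
  (* The relation with both indices equal to the first forces this choice of [v]. *)
  - exists (w1 \wedge w1); split.
    + exact: (wedge_form form_w1 form_w1).
    + move=> j y jy; have [E [J [sE sJ he [h1 h2 h3]]]] := point j y jy.
      by have [h _] := su2_volume_neq0 sE c0 he h1 (is_form_antisym form_w1 jy);
        exact: h.
    + move=> j y jy; have [E [J [sE sJ he [h1 h2 h3]]]] := point j y jy.
      by have [_ h] := su2_volume_neq0 sE c0 he h1 (is_form_antisym form_w1 jy);
        exact: h.
    + move=> a b j y jy V; have [E [J [sE sJ he [h1 h2 h3]]]] := point j y jy.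
      have := su2_wedge_relations sJ h1 h2 h3 (is_form_antisym form_w1 jy)
        (is_form_antisym form_w2 jy) (is_form_antisym form_w3 jy) a b V.
      suff e (a' : 'I_3) : tnth [tuple w1; w2; w3] a' j =
        tnth [tuple w1 j; w2 j; w3 j] a' by rewrite /wedge !e => ->.
      by case: a' => -[|[|[|//]]] h; rewrite (tnth_nth w1) (tnth_nth (w1 j)).
  - move=> j y jy; have [E [J [sE sJ he [h1 h2 h3]]]] := point j y jy.
    exact: (su2_positive sE sJ c0 h1 h2 h3).
have desc0 k : descends_to U pr (0 : tfield M k) (0 : tfield N k) by [].
have vanish k (w : tfield M k.+1) (t : tfield N k.+1) : is_form t ->
    descends_to U pr w t -> eq_field (ext w) 0 -> eq_field (ext t) 0.
  move=> ft hd e; apply: (descends_eq sub surj _ (@desc0 _) e).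
  exact: (ext_descends oU sub ft hd).
have f1 : is_form (eta \wedge w1 : tfield N 3) by exact: (wedge_form form_eta
  form_w1).
have f2 : is_form (eta \wedge w2 : tfield N 3) by exact: (wedge_form form_eta
  form_w2).
have d1 : eq_field (ext (eta \wedge w1 : tfield N 3)) 0.
  apply: (vanish 2 _ _ f1 (wedge_descends heta hw1)).
  exact: (ext_eta_omega1 hflat hg hX c0 hc hLF).
have d2 : eq_field (ext (eta \wedge w2 : tfield N 3)) 0.
  apply: (vanish 2 _ _ f2 (wedge_descends heta hw2)).
  exact: (ext_eta_omega2 hflat hg hX c0 hc hLPsip halpha).
split; first split=> //.
  apply: (vanish 1 _ _ form_w3 hw3).
  exact: (ext_oppr_iprod_Psip hflat hX hLPsip).
move=> hcontact; split=> //.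
apply: (descends_eq sub surj (ext_descends oU sub form_eta heta) _
  (ext_eta hflat hX hLF hcontact)).
move=> q i j Uq iq jq V.
exact: (congr1 (fun z => - 2 * z) (hw3 q i j Uq iq jq V)).
Qed.
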